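(* Let $L$ be a field and $\sigma$ an automorphism of $L$ such that $\sigma\ne\mathrm{id}_L$ and, for each $l\in L\setminus L^\sigma$, $\sigma^i(l)\ne l$ for all $i\ge1$. Then the skew Laurent series ring $\mathcal L=L[[X,X^{-1};\sigma]]$ satisfies the commutative centralizer condition. Moreover: (1) If $u\in L\setminus L^\sigma$, then $C(u)=L$. (2) If $u\in\mathcal L\setminus L$, $\deg u=0$, and the leading coefficient $u_0$ of $u$ does not belong to $L^\sigma$, then $C(u)\subseteq\mathcal L_-$, the map $C(u)\to L=\mathcal L_-/\mathcal L_-X^{-1}$, $c\mapsto c+\mathcal L_-X^{-1}$, is an $L^\sigma$-algebra isomorphism, and $[C(u):L^\sigma(u)]=[L:L^\sigma(u_0)]$. (3) If $u\in\mathcal L\setminus L$ with $\deg u\ne0$, then $C(u)=L^\sigma[[v,v^{-1}]]$ is a Laurent series field with coefficients from the field $L^\sigma$, where $v$ is an element of $C(u)$ which has the least positive degree, and $[C(u):L^\sigma[[u,u^{-1}]]]=\left|\frac{\deg u}{\deg v}\right|<\infty$.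
   Context: $L^\sigma=\{l\in L:\sigma(l)=l\}$. The skew Laurent series algebra $\mathcal L=L[[X,X^{-1};\sigma]]$ consists of (inverse) Laurent series $a=\sum_{i=-\infty}^{n}a_iX^i$ with $n\in\mathbb Z$, $a_i\in L$, with componentwise addition and multiplication $ab=\sum_i\big(\sum_{j+k=i}a_j\sigma^j(b_k)\big)X^i$ (so $Xl=\sigma(l)X$); it is a division ring. For $a\neq0$, $\deg a$ is the maximal $n$ with $a_n\ne0$, and $a_n$ is the leading coefficient; $\deg 0=-\infty$. $\mathcal L_-=\{a\in\mathcal L:\deg a\le0\}$ is a local ring with maximal ideal $\mathcal L_-X^{-1}$ and residue ring $\mathcal L_-/\mathcal L_-X^{-1}$ canonically isomorphic to $L$. $C(u)$ is the centralizer of $u$ in $\mathcal L$. A noncommutative ring satisfies the commutative centralizer condition if the centralizer of each non-central element is commutative. $[E:F]$ is the dimension of a field extension $E$ of $F$. For $w\in\mathcal L$ with $\deg w\ne0$, $L^\sigma[[w,w^{-1}]]$ denotes the field of all series $\sum_i\lambda_iw^i$, $\lambda_i\in L^\sigma$, that make sense in $\mathcal L$: those with only finitely many nonzero terms of positive degree (i.e. $i$ bounded above if $\deg w>0$, bounded below if $\deg w<0$). *)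

(* Defs.v *)
From HB Require Import structures.
From mathcomp Require Import all_boot all_order all_algebra zify.
From mathcomp Require Import boolp classical_sets functions cardinality fsbigop.
From mathcomp Require Import constructive_ereal.

Set Implicit Arguments.
Unset Strict Implicit.
Unset Printing Implicit Defensive.

Import Order.TTheory GRing.Theory Num.Theory.

Local Open Scope classical_set_scope.
Local Open Scope ring_scope.

Section FieldAutomorphisms.
Variable L : fieldType.

Record field_aut := FieldAut {
  aut_fun :> {rmorphism L -> L};
  aut_inv : L -> L;
  autK : cancel aut_fun aut_inv;
  autVK : cancel aut_inv aut_fun }.

Definition id_aut : field_aut :=
  @FieldAut idfun id (fun=> erefl) (fun=> erefl).

Definition aut_exp (s : field_aut) (j : int) : L -> L :=
  match j with Posz n => iter n s | Negz n => iter n.+1 (aut_inv s) end.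

Lemma aut_exp1z s j x : aut_exp s (1 + j) x = s (aut_exp s j x).
Proof.
case: j => [n|[|n]] //; first by rewrite /= autVK.
have -> : 1 + Negz n.+1 = Negz n by lia.
by rewrite /= autVK.
Qed.

Lemma aut_expN1z s j x : aut_exp s (-1 + j) x = aut_inv s (aut_exp s j x).
Proof.
have -> : j = 1 + (-1 + j) by rewrite addrA subrr add0r.
by rewrite aut_exp1z autK addrA; congr aut_exp; lia.
Qed.

Lemma aut_expD s i j x : aut_exp s (i + j) x = aut_exp s i (aut_exp s j x).
Proof.
elim/int_ind: i => [|n IH|n IH]; first by rewrite add0r.
  by rewrite intS -addrA !aut_exp1z IH.
by rewrite intS opprD -addrA !aut_expN1z IH.
Qed.

Section AutExpMorphism.
Variables (s : field_aut) (j : int).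

Lemma aut_exp_zmod_morphism : zmod_morphism (aut_exp s j).
Proof.
move=> x y; elim/int_ind: j => [|n IH|n IH] //.
  by rewrite intS !aut_exp1z IH rmorphB.
by rewrite intS opprD !aut_expN1z IH; apply: (can_inj (autK s));
   rewrite rmorphB !autVK.
Qed.

Lemma aut_exp_monoid_morphism : monoid_morphism (aut_exp s j).
Proof.
split.
  elim/int_ind: j => [|n IH|n IH] //; first by rewrite intS aut_exp1z IH rmorph1.
  by rewrite intS opprD aut_expN1z IH; apply: (can_inj (autK s));
     rewrite autVK rmorph1.
move=> x y; elim/int_ind: j => [|n IH|n IH] //.
  by rewrite intS !aut_exp1z IH rmorphM.
by rewrite intS opprD !aut_expN1z IH; apply: (can_inj (autK s));
   rewrite rmorphM !autVK.
Qed.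

HB.instance Definition _ :=
  GRing.isZmodMorphism.Build L L (aut_exp s j) aut_exp_zmod_morphism.
HB.instance Definition _ :=
  GRing.isMonoidMorphism.Build L L (aut_exp s j) aut_exp_monoid_morphism.
End AutExpMorphism.

Section FixedField.
Variable s : field_aut.

Definition is_fixed : {pred L} := fun x => s x == x.

Lemma is_fixed_divring : divring_closed is_fixed.
Proof.
split=> [|x y /eqP hx /eqP hy|x y /eqP hx /eqP hy]; rewrite unfold_in.
- by rewrite rmorph1.
- by rewrite rmorphB hx hy.
- by rewrite fmorph_div hx hy.
Qed.

HB.instance Definition _ :=
  GRing.isDivringClosed.Build L is_fixed is_fixed_divring.

Record fixed_field :=
  FixedField { fixed_val : L; fixed_valP : fixed_val \in is_fixed }.
HB.instance Definition _ := [isSub for fixed_val].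
HB.instance Definition _ := [Choice of fixed_field by <:].
HB.instance Definition _ := [SubChoice_isSubIntegralDomain of fixed_field by <:].
HB.instance Definition _ := [SubIntegralDomain_isSubField of fixed_field by <:].
End FixedField.
End FieldAutomorphisms.

Definition bounded_above (L : fieldType) : {pred int -> L} :=
  fun f => `[< exists N : int, forall n, N < n -> f n = 0 >].

Lemma bounded_above_zmod (L : fieldType) : zmod_closed (@bounded_above L).
Proof.
split=> [|f g /asboolP[N hN] /asboolP[M hM]]; apply/asboolP; first by exists 0.
exists (Num.max N M) => n; rewrite gt_max => /andP[Nn Mn].
rewrite (_ : (f - g) n = f n - g n) //; by rewrite hN // hM // subr0.
Qed.

HB.instance Definition _ (L : fieldType) :=
  GRing.isZmodClosed.Build (int -> L) (@bounded_above L) (@bounded_above_zmod L).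

(* s is a parameter because the multiplication depends on it. *)
Record skew_laurent (L : fieldType) (s : field_aut L) :=
  SkewLaurent { coef : int -> L; coefP : coef \in @bounded_above L }.
Arguments coef {L s} _ _.

Section SkewLaurent.
Variables (L : fieldType) (s : field_aut L).
Local Notation bounded_above := (@bounded_above L).
Local Notation skew_laurent := (skew_laurent s).

HB.instance Definition _ := [isSub of skew_laurent for @coef L s].
HB.instance Definition _ := [Choice of skew_laurent by <:].
HB.instance Definition _ := [SubChoice_isSubZmodule of skew_laurent by <:].

Implicit Types (a b c : skew_laurent) (f g h : int -> L) (l : L) (m n : int).

Lemma skewP a b : coef a =1 coef b -> a = b.
Proof. by move=> ab; apply/val_inj/funext. Qed.

Lemma coef0 n : coef 0 n = 0. Proof. by []. Qed.
Lemma coefD a b n : coef (a + b) n = coef a n + coef b n. Proof. by []. Qed.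
Lemma coefN a n : coef (- a) n = - coef a n. Proof. by []. Qed.
Lemma coefB a b n : coef (a - b) n = coef a n - coef b n. Proof. by []. Qed.

Definition conv f g n : L :=
  \sum_(j \in [set: int]) f j * aut_exp s j (g (n - j)).

Let box (N : nat) : set int := [set j | (`|j| <= N)%N].

Let finite_box N : finite_set (box N).
Proof.
apply: (@sub_finite_set _ _ ((fun k : nat => k%:Z - N%:Z) @` `I_(N + N).+1)).
  move=> j; rewrite /box /= => hj; by exists (absz (j + N%:Z)) => /=; lia.
exact/finite_image/finite_II.
Qed.

Let sum_box N (F : int -> L) : (forall j, (N < `|j|)%N -> F j = 0) ->
  \sum_(j \in [set: int]) F j = \sum_(j \in box N) F j.
Proof.
move=> hF; apply/esym/fsbig_widen => // j [_ /= /negP].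
by rewrite -ltnNge => /hF.
Qed.

Let bnd (N : nat) f := forall n, N%:Z < n -> f n = 0.

Let bndW N M f : (N <= M)%N -> bnd N f -> bnd M f.
Proof. by move=> NM hf n Mn; apply: hf; lia. Qed.

Let bndP f : f \in bounded_above -> exists N, bnd N f.
Proof.
by move=> /asboolP[N hN]; exists `|N|%N => n Nn; apply: hN; lia.
Qed.

Let bnd2P f g : f \in bounded_above -> g \in bounded_above ->
  exists N, bnd N f /\ bnd N g.
Proof.
move=> /bndP[N hN] /bndP[M hM]; exists (maxn N M).
by split; [apply: bndW hN|apply: bndW hM]; lia.
Qed.

Let conv0 N f g n j : bnd N f -> bnd N g -> (N + `|n|%N < `|j|)%N ->
  f j * aut_exp s j (g (n - j)) = 0.
Proof.
move=> hf hg hj; have [/hf ->|jN] := ltP N%:Z j; first by rewrite mul0r.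
by rewrite (hg (n - j)) ?rmorph0 ?mulr0 //; lia.
Qed.

Let convE M N f g n : bnd N f -> bnd N g -> (N + `|n| <= M)%N ->
  conv f g n = \sum_(j \in box M) f j * aut_exp s j (g (n - j)).
Proof.
by move=> hf hg hM; apply: sum_box => j hj; apply: conv0 hf hg _; lia.
Qed.

Let conv_bnd N f g : bnd N f -> bnd N g -> bnd (N + N) (conv f g).
Proof.
move=> hf hg n hn; apply: fsbig1 => j _.
have [/hf ->|jN] := ltP N%:Z j; first by rewrite mul0r.
by rewrite (hg (n - j)) ?rmorph0 ?mulr0 //; lia.
Qed.

Lemma conv_bounded_above a b : conv (coef a) (coef b) \in bounded_above.
Proof.
have [N [ha hb]] := bnd2P (coefP a) (coefP b).
by apply/asboolP; exists (N + N)%N; apply: conv_bnd.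
Qed.

Definition skew_mul a b : skew_laurent := SkewLaurent s (conv_bounded_above a b).

Lemma monomial_bounded_above l m :
  (fun n => if n == m then l else 0) \in bounded_above.
Proof. by apply/asboolP; exists m => n; case: eqP => // ->; rewrite ltxx. Qed.

(* l X^m *)
Definition monomial l m : skew_laurent :=
  SkewLaurent s (monomial_bounded_above l m).

Lemma coef_monomial l m n : coef (monomial l m) n = if n == m then l else 0.
Proof. by []. Qed.

Lemma coef_monomial_mul l m b n :
  coef (skew_mul (monomial l m) b) n = l * aut_exp s m (coef b (n - m)).
Proof.
rewrite /= /conv -(fsbig_widen [set m]) //; last first.
  by move=> j [_ /eqP /negbTE /= ->]; rewrite mul0r.
by rewrite fsbig_set1 eqxx.
Qed.

Lemma coef_mul_monomial b l m n :
  coef (skew_mul b (monomial l m)) n = coef b (n - m) * aut_exp s (n - m) l.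
Proof.
rewrite /= /conv -(fsbig_widen [set n - m]) //; last first.
  move=> j [_ /eqP /= hj]; rewrite ifF ?rmorph0 ?mulr0 //.
  by apply: contraNF hj => /eqP <-; rewrite subKr.
by rewrite fsbig_set1 subKr eqxx.
Qed.

Lemma skew_mulA : associative skew_mul.
Proof.
move=> a b c; apply: skewP => n /=.
have [N [ha hb]] := bnd2P (coefP a) (coefP b).
have [N' hc] := bndP (coefP c).
pose A := (N + N')%N.
have {}ha : bnd A (coef a) by apply: bndW ha; lia.
have {}hb : bnd A (coef b) by apply: bndW hb; lia.
have {}hc : bnd A (coef c) by apply: bndW hc; lia.
pose M := (A + A + A + A + `|n|)%N.
pose F i j := coef a i * aut_exp s i (coef b (j - i)) * aut_exp s j (coef c (n - j)).
have bigF i j : ((M < `|i|) || (M < `|j|))%N -> F i j = 0.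
  move=> hij; rewrite /F.
  have [/ha ->|iA] := ltP A%:Z i; first by rewrite !mul0r.
  have [/hb ->|jA] := ltP A%:Z (j - i); first by rewrite rmorph0 mulr0 mul0r.
  by rewrite (hc (n - j)) ?rmorph0 ?mulr0 //; lia.
transitivity (\sum_(i \in box M) \sum_(j \in box M) F i j).
  rewrite /conv (sum_box (N := M)); last first.
    move=> i hi; rewrite (_ : \sum_(j \in _) _ = conv (coef b) (coef c) (n - i)) //.
    have [/ha ->|iA] := ltP A%:Z i; first by rewrite !mul0r.
    by rewrite (conv_bnd hb hc) ?rmorph0 ?mulr0 //; lia.
  apply: eq_fsbigr => i; rewrite inE /box /= => hi.
  rewrite (sum_box (N := (M + M)%N)); last first.
    by move=> j hj; apply: conv0 hb hc _; lia.
  rewrite fsbig_finite ?finite_box //= raddf_sum big_distrr /= -fsbig_finite //.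
  transitivity (\sum_(j \in [set: int]) F i j); last first.
    by apply: sum_box => j hj; rewrite bigF // hj orbT.
  rewrite (reindex_fsbigT (fun k => i + k)); last first.
    by exists (fun k => k - i) => k; rewrite ?(addrC i) ?addrK ?subrK.
  rewrite (sum_box (N := (M + M)%N)); last by move=> j hj; apply: bigF; lia.
  apply: eq_fsbigr => k _; rewrite /F (_ : i + k - i = k) ?[in RHS]aut_expD; last first.
    by rewrite addrC addKr.
  by rewrite rmorphM mulrA opprD addrA.
rewrite exchange_fsbig //= [RHS](sum_box (N := M)); last first.
  by move=> j hj; apply: conv0 (conv_bnd ha hb) (bndW _ hc) _; lia.
apply: eq_fsbigr => j; rewrite inE /box /= => hj.
rewrite /conv (sum_box (N := (M + M)%N)); last first.
  by move=> i hi; apply: conv0 ha hb _; lia.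
rewrite [in RHS]fsbig_finite ?finite_box // big_distrl /= -fsbig_finite //.
apply: fsbig_widen => i; rewrite /box /=; first by lia.
by move=> [_ hi]; rewrite bigF //; lia.
Qed.

Lemma skew_mul1l : left_id (monomial 1 0) skew_mul.
Proof. by move=> a; apply: skewP => n; rewrite coef_monomial_mul subr0 mul1r. Qed.

Lemma skew_mul1r : right_id (monomial 1 0) skew_mul.
Proof.
by move=> a; apply: skewP => n; rewrite coef_mul_monomial subr0 rmorph1 mulr1.
Qed.

Lemma skew_mulDl : left_distributive skew_mul +%R.
Proof.
move=> a b c; apply: skewP => n; rewrite coefD /=.
have [N [ha hb]] := bnd2P (coefP a) (coefP b).
have [N' hc] := bndP (coefP c).
pose A := (N + N')%N.
have {}ha : bnd A (coef a) by apply: bndW ha; lia.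
have {}hb : bnd A (coef b) by apply: bndW hb; lia.
have {}hc : bnd A (coef c) by apply: bndW hc; lia.
have hab : bnd A (coef (a + b)) by move=> k hk; rewrite coefD ha // hb // addr0.
rewrite (convE hab hc (leqnn _)) (convE ha hc (leqnn _)) (convE hb hc (leqnn _)).
by rewrite -fsbig_split //=; apply: eq_fsbigr => j _; exact: mulrDl.
Qed.

Lemma skew_mulDr : right_distributive skew_mul +%R.
Proof.
move=> c a b; apply: skewP => n; rewrite coefD /=.
have [N [ha hb]] := bnd2P (coefP a) (coefP b).
have [N' hc] := bndP (coefP c).
pose A := (N + N')%N.
have {}ha : bnd A (coef a) by apply: bndW ha; lia.
have {}hb : bnd A (coef b) by apply: bndW hb; lia.
have {}hc : bnd A (coef c) by apply: bndW hc; lia.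
have hab : bnd A (coef (a + b)) by move=> k hk; rewrite coefD ha // hb // addr0.
rewrite (convE hc hab (leqnn _)) (convE hc ha (leqnn _)) (convE hc hb (leqnn _)).
by rewrite -fsbig_split //=; apply: eq_fsbigr => j _; rewrite -mulrDr -rmorphD.
Qed.

Lemma skew_1_neq0 : monomial 1 0 != 0.
Proof. by apply/eqP => /(congr1 (fun a => coef a 0))/eqP; rewrite coef0 /= oner_eq0. Qed.

HB.instance Definition _ := GRing.Zmodule_isNzRing.Build skew_laurent
  skew_mulA skew_mul1l skew_mul1r skew_mulDl skew_mulDr skew_1_neq0.

Lemma coefM a b n :
  coef (a * b) n =
  \sum_(j \in [set: int]) coef a j * aut_exp s j (coef b (n - j)).
Proof. by []. Qed.

Definition is_inverse a b := b * a = 1 /\ a * b = 1.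
Definition skew_unit : pred skew_laurent := fun a => `[< exists b, is_inverse a b >].
Definition skew_inv a : skew_laurent := xget a [set b | is_inverse a b].

Lemma skew_invP a : skew_unit a -> is_inverse a (skew_inv a).
Proof. by move=> /asboolP ex; apply: (@xgetPex _ a [set b | is_inverse a b]). Qed.

Lemma skew_mulVr : {in skew_unit, left_inverse 1 skew_inv *%R}.
Proof. by move=> a /skew_invP[]. Qed.

Lemma skew_divrr : {in skew_unit, right_inverse 1 skew_inv *%R}.
Proof. by move=> a /skew_invP[]. Qed.

Lemma skew_unitP a b : b * a = 1 /\ a * b = 1 -> skew_unit a.
Proof. by move=> ab; apply/asboolP; exists b. Qed.

Lemma skew_inv_out : {in [predC skew_unit], skew_inv =1 id}.
Proof. by move=> a /asboolP ha; apply: xgetPN => b hb; apply: ha; exists b. Qed.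

HB.instance Definition _ := GRing.NzRing_hasMulInverse.Build skew_laurent
  skew_mulVr skew_divrr skew_unitP skew_inv_out.

End SkewLaurent.

Section Degree.
Variables (L : fieldType) (s : field_aut L).
Implicit Types (a b : skew_laurent s) (l : L) (m n : int).

Lemma monomialM l l' m n :
  monomial s l m * monomial s l' n = monomial s (l * aut_exp s m l') (m + n).
Proof.
apply: skewP => i; rewrite coef_monomial_mul !coef_monomial subr_eq addrC.
by case: eqP => // _; rewrite rmorph0 mulr0.
Qed.

Definition const l : skew_laurent s := monomial s l 0.

Lemma const_zmod_morphism : zmod_morphism const.
Proof.
move=> l l'; apply: skewP => n; rewrite coefB !coef_monomial.
by case: eqP => // _; rewrite subr0.
Qed.

Lemma const_monoid_morphism : monoid_morphism const.
Proof. by split=> // l l'; rewrite monomialM. Qed.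

HB.instance Definition _ :=
  GRing.isZmodMorphism.Build L (skew_laurent s) const const_zmod_morphism.
HB.instance Definition _ :=
  GRing.isMonoidMorphism.Build L (skew_laurent s) const const_monoid_morphism.

Definition is_deg a n := coef a n != 0 /\ forall m, n < m -> coef a m = 0.

Definition deg a : \bar int :=
  if a == 0 then -oo%E else (xget 0 [set n | is_deg a n])%:E.

Definition leading_coef a : L := coef a (fine (deg a)).

Lemma is_deg_uniq a m n : is_deg a m -> is_deg a n -> m = n.
Proof.
move=> [am hm] [an hn]; case: (ltgtP m n) => // [/hm|/hn] e.
  by rewrite e eqxx in an.
by rewrite e eqxx in am.
Qed.

Lemma is_deg_ex a : a != 0 -> exists n, is_deg a n.
Proof.
move=> a0; have [N hN] : exists N : int, forall n, N < n -> coef a n = 0.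
  by apply/asboolP; exact: (coefP a).
have ex : exists k : nat, coef a (N - k%:Z) != 0.
  apply: contrapT => nex; move/eqP: a0; apply; apply: skewP => n.
  rewrite coef0; have [/hN //|nN] := ltP N n.
  apply/eqP/negPn/negP => an; apply: nex; exists (absz (N - n)).
  by have -> : N - (absz (N - n))%:Z = n by lia.
case: (ex_minnP ex) => k ak kmin; exists (N - k%:Z); split=> // m hm.
have [/hN //|mN] := ltP N m.
apply/eqP/negPn/negP => am.
have := kmin (absz (N - m)); have -> : N - (absz (N - m))%:Z = m by lia.
by move=> /(_ am); lia.
Qed.

Lemma deg0 : deg 0 = -oo%E. Proof. by rewrite /deg eqxx. Qed.

Lemma degE a n : is_deg a n -> deg a = n%:E.
Proof.
move=> an; rewrite /deg ifF; last first.
  by apply/eqP => a0; case: an; rewrite a0 coef0 eqxx.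
by congr EFin; apply: xget_unique => // m am; apply: is_deg_uniq am an.
Qed.

Lemma deg_leP a n :
  (deg a <= n%:E)%E <-> forall m, n < m -> coef a m = 0.
Proof.
have [->|/is_deg_ex[d ad]] := eqVneq a 0; first by rewrite deg0 leNye.
rewrite (degE ad) lee_fin; case: ad => ad hd; split=> [dn m nm|h].
  exact/hd/(le_lt_trans dn).
by rewrite leNgt; apply/negP => /h e; rewrite e eqxx in ad.
Qed.

Definition X : skew_laurent s := monomial s 1 1.

Lemma X_inv : X^-1 = monomial s 1 (-1).
Proof.
have h : monomial s 1 (-1) * X = 1 by rewrite monomialM rmorph1 mulr1 addNr.
have h' : X * monomial s 1 (-1) = 1 by rewrite monomialM rmorph1 mulr1 subrr.
have Xu : X \is a GRing.unit by apply/unitrP; exists (monomial s 1 (-1)).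
by rewrite -[LHS]mul1r -h mulrK.
Qed.

Lemma X_const l : X * const l = const (s l) * X.
Proof. by rewrite !monomialM rmorph1 mulr1 mul1r addrC. Qed.

Definition nonpos_deg : set (skew_laurent s) := [set a | (deg a <= 0)%E].

Definition nonpos_deg_max : set (skew_laurent s) :=
  [set d * X^-1 | d in nonpos_deg].

(* The element of L identified with the class of a modulo nonpos_deg_max. *)
Definition residue a : L := xget 0 [set l | nonpos_deg_max (a - const l)].

Lemma nonpos_deg_maxE a :
  nonpos_deg_max a <-> forall n, 0 <= n -> coef a n = 0.
Proof.
split=> [[d /deg_leP hd <-] n n0|h].
  by rewrite X_inv coef_mul_monomial hd ?mul0r //; lia.
have hX : X \is a GRing.unit.
  apply/unitrP; exists (monomial s 1 (-1)).
  by rewrite !monomialM !rmorph1 !mulr1 addNr subrr.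
exists (a * X); last by rewrite mulrK.
by apply/deg_leP => n n0; rewrite coef_mul_monomial h ?mul0r //; lia.
Qed.

Lemma residueE a : nonpos_deg a -> residue a = coef a 0.
Proof.
move=> /deg_leP ha; apply: xget_unique => [|l /nonpos_deg_maxE /(_ 0 (lexx _))].
  apply/nonpos_deg_maxE => n; rewrite le_eqVlt coefB coef_monomial => /orP[/eqP<-|n0].
    by rewrite eqxx subrr.
  by rewrite ha // gt_eqF // subr0.
by move/eqP; rewrite coefB coef_monomial eqxx subr_eq0 => /eqP.
Qed.

End Degree.
Arguments nonpos_deg {L} s _.
Arguments residue {L s} a.

Section Extensions.
Variable R : unitRingType.
Implicit Types (E F B : set R) (u : R).

Definition centralizer u : set R := [set c | GRing.comm c u].

Definition commutative_centralizer_condition : Prop :=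
  (exists a b : R, a * b <> b * a) /\
  forall u, (exists a : R, ~ GRing.comm a u) ->
    {in centralizer u &, commutative (@GRing.mul R)}.

Definition is_subfield E : Prop :=
  divring_closed (mem E) /\ {in E &, commutative (@GRing.mul R)}.

(* F(u); a priori only a division subring, since R need not be commutative. *)
Definition adjoin F u : set R :=
  smallest [set K | divring_closed (mem K)] (F `|` [set u]).

Definition is_basis F E B : Prop :=
  [/\ B `<=` E,
      forall x, E x -> exists (r : seq R) (c : R -> R),
        [/\ [set` r] `<=` B, range c `<=` F & x = \sum_(b <- r) c b * b]
    & forall (r : seq R) (c : R -> R),
        uniq r -> [set` r] `<=` B -> range c `<=` F ->
        \sum_(b <- r) c b * b = 0 -> {in r, forall b, c b = 0}].

(* [E : F] is the cardinality, possibly infinite, of D. *)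
Definition has_ext_degree F E (T : Type) (D : set T) : Prop :=
  [/\ is_subfield F, is_subfield E, F `<=` E &
      exists2 B, is_basis F E B & (B #= D)%card].

End Extensions.

Section Centralizers.
Variables (L : fieldType) (s : field_aut L).
Implicit Types (u v w a : skew_laurent s) (E : set (skew_laurent s)).

Definition fixed_set : set L := [set l | s l = l].

Definition fixed_consts : set (skew_laurent s) := const s @` fixed_set.

Definition fixed_algebra_iso E (phi : skew_laurent s -> L) : Prop :=
  [/\ subring_closed (mem E), fixed_consts `<=` E, set_bij E [set: L] phi
    & [/\ phi 1 = 1, {in E &, {morph phi : a b / a + b}},
          {in E &, {morph phi : a b / a * b}}
        & forall l a, fixed_set l -> E a -> phi (const s l * a) = l * phi a]].

Definition least_pos_deg E v : Prop :=
  [/\ E v, (0 < deg v)%E & forall a, E a -> (0 < deg a)%E -> (deg v <= deg a)%E].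

Definition summable w (f : int -> fixed_field s) : Prop :=
  ((0 < deg w)%E -> exists N : int, forall i, N < i -> f i = 0) /\
  ((deg w < 0)%E -> exists N : int, forall i, i < N -> f i = 0).

(* a = \sum_i (f i) w^i. The sum is taken coefficientwise; finiteness is
   required because \sum_(i \in _) is 0 on an infinite support. *)
Definition is_series w (f : int -> fixed_field s) a : Prop :=
  forall n : int,
    finite_set [set i : int | fixed_val (f i) * coef (w ^ i) n != 0] /\
    coef a n = \sum_(i \in [set: int]) fixed_val (f i) * coef (w ^ i) n.

(* L^s[[w, w^-1]], meant for w of nonzero degree *)
Definition series_in w : set (skew_laurent s) :=
  [set a | exists2 f, summable w f & is_series w f a].

(* The series ring over the identity automorphism of L^s is the field of
   (inverse) Laurent series in a commuting variable, which phi sends to v. *)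
Definition laurent_series_field_in v E : Prop :=
  exists phi : {rmorphism skew_laurent (id_aut (fixed_field s)) -> skew_laurent s},
    [/\ injective phi, range phi = E & forall f, is_series v (coef f) (phi f)].

End Centralizers.
Arguments fixed_consts {L} s _.

(* Main.v *)
From Pilot Require Import Defs.
From HB Require Import structures.
From mathcomp Require Import all_boot all_order all_algebra zify.
From mathcomp Require Import boolp classical_sets functions cardinality fsbigop.
From mathcomp Require Import constructive_ereal.

(* Names such as [coef0] and [coefM] are those for skew Laurent series, not for
   polynomials. *)
Import Pilot.Defs.

Set Implicit Arguments.
Unset Strict Implicit.
Unset Printing Implicit Defensive.

Import Order.TTheory GRing.Theory Num.Theory.

Local Open Scope classical_set_scope.
Local Open Scope ring_scope.

(** Write [C(u)] for the centralizer of [u].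

    Elements of degree zero. The constant [l] commutes with [c] if and only if
    [c_n s^n(l) = l c_n] for all [n]; when [l] is not fixed by [s], no nontrivial
    power of [s] fixes [l], so [C(l) = L] ([centralizer_const]). A series [u] of degree
    [0] with such a leading coefficient [l] is conjugate to [l]: the equation
    [w u = l w] with [w = 1 + ...] is solved for one coefficient of [w] after the
    other ([conj_const]), dividing each time by some [l - s^n(l)]. Hence [C(u)] is
    conjugate to [L], and the conjugation is inverse to the residue map
    ([centralizer_deg0]). It carries [L^s(l)] to [L^s(u)], so a basis of [L] over the
    former, which exists by Zorn's lemma ([basis_exists]), is carried to a basis of
    [C(u)] over the latter.

    Elements of nonzero degree [d]. If [a] and [b] in [C(u)] have the same degree, the
    ratio of their leading coefficients is fixed by [s^d], hence by [s]
    ([leading_ratio_fixed]). So, up to terms of lower degree, [C(u)] contains in each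
    degree at most one element up to a scalar of [L^s], and these scalars are central.
    The degrees occurring are the multiples of the least positive one, [e = deg v].
    Given elements [w k] of [C(u)] of degree [k e] for all integers [k], successive
    approximation expands each element of [C(u)] as a series in the [w k] with
    coefficients in [L^s] ([centralizer_expansion]). For [w k = v^k] this gives
    [C(u) = L^s[[v, v^-1]]], and evaluation at [v] is a ring morphism
    ([power_series_monoid_morphism]), so [C(u)] is commutative. If [deg u = n e] with
    [n > 0], the family [w (i n + j) = u^i v^j], [0 <= j < n], shows instead that
    [1, v, ..., v^(n-1)] span [C(u)] over [L^s[[u, u^-1]]] ([series_interleave]); they
    are independent since degrees modulo [n e] keep them apart
    ([centralizer_ext_degree]).

    A noncentral element has one of the forms treated above, up to subtracting a fixed
    constant, which does not change its centralizer. Inverses, the conjugating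
    series [w] and the expansions are limits for the filtration by degree
    ([skew_limit], [contraction_fixpoint]). *)

(** * Degrees, completeness and inverses *)

Section DegreeBounds.
Variables (L : fieldType) (s : field_aut L).
Implicit Types (a b c x y : skew_laurent s) (l : L) (d m n : int).

(** An upper bound for the degree. Stated on coefficients, it covers [0] and needs
    no extended integers. *)
Definition deg_le a n := forall m, n < m -> coef a m = 0.

Lemma is_deg_le a d : is_deg a d -> deg_le a d.
Proof. by case. Qed.

Lemma is_deg_neq0 a d : is_deg a d -> a != 0.
Proof. by case=> ad _; apply: contraNneq ad => ->; rewrite coef0. Qed.

Lemma deg_leW a m n : m <= n -> deg_le a m -> deg_le a n.
Proof. by move=> mn am k nk; apply: am; apply: le_lt_trans nk. Qed.

Lemma deg_le0 n : deg_le 0 n. Proof. by move=> m _. Qed.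

Lemma deg_leD a b n : deg_le a n -> deg_le b n -> deg_le (a + b) n.
Proof. by move=> an bn m nm; rewrite coefD an // bn // addr0. Qed.

Lemma deg_leN a n : deg_le a n -> deg_le (- a) n.
Proof. by move=> an m nm; rewrite coefN an // oppr0. Qed.

Lemma deg_leB a b n : deg_le a n -> deg_le b n -> deg_le (a - b) n.
Proof. by move=> an bn; apply/deg_leD/deg_leN. Qed.

Lemma deg_le_ex a : exists n, deg_le a n.
Proof. exact/asboolP/(coefP a). Qed.

Lemma deg_le_monomial l n : deg_le (monomial s l n) n.
Proof. by move=> m nm; rewrite coef_monomial gt_eqF. Qed.

Lemma is_deg_monomial l n : l != 0 -> is_deg (monomial s l n) n.
Proof. by move=> l0; split; [rewrite coef_monomial eqxx | exact: deg_le_monomial]. Qed.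

Lemma deg_le_eq0 a (n : nat -> int) :
  (forall k, deg_le a (n k)) -> (forall m, exists k, n k < m) -> a = 0.
Proof. by move=> an nm; apply: skewP => m; have [k /an] := nm m. Qed.

Lemma deg_leM a b m n : deg_le a m -> deg_le b n -> deg_le (a * b) (m + n).
Proof.
move=> am bn k mnk; rewrite coefM fsbig1 // => j _.
have [/am ->|jm] := ltP m j; first by rewrite mul0r.
by rewrite bn ?rmorph0 ?mulr0 //; lia.
Qed.

(** In degree [m + n] the convolution has at most one nonzero term. *)
Lemma coefM_top a b m n : deg_le a m -> deg_le b n ->
  coef (a * b) (m + n) = coef a m * aut_exp s m (coef b n).
Proof.
move=> am bn; rewrite coefM -(fsbig_widen [set m]) //.
  by rewrite fsbig_set1 addrC addKr.
move=> j [_ /eqP /= jm]; have [/am ->|jlem] := ltP m j; first by rewrite mul0r.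
by rewrite bn ?rmorph0 ?mulr0 //; move/eqP in jm; lia.
Qed.

Lemma deg_leM0 a b : deg_le a 0 -> deg_le b 0 -> deg_le (a * b) 0.
Proof. exact: (@deg_leM a b 0 0). Qed.

Lemma coefM0 a b : deg_le a 0 -> deg_le b 0 ->
  coef (a * b) 0 = coef a 0 * coef b 0.
Proof. exact: (@coefM_top a b 0 0). Qed.

Lemma is_degM a b m n : is_deg a m -> is_deg b n -> is_deg (a * b) (m + n).
Proof.
move=> [a0 am] [b0 bn]; split; last exact: deg_leM.
by rewrite coefM_top // mulf_neq0 // fmorph_eq0.
Qed.

Lemma coef_one n : coef (1 : skew_laurent s) n = if n == 0 then 1 else 0.
Proof. by []. Qed.

Lemma is_deg1 : is_deg (1 : skew_laurent s) 0.
Proof. exact/is_deg_monomial/oner_neq0. Qed.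

(** Completeness for the filtration by degree. Each coefficient of [a k] is
    eventually constant in [k]; the limit collects these constants. *)
Lemma skew_limit (a : nat -> skew_laurent s) n :
    deg_le (a 0%N) n -> (forall k, deg_le (a k.+1 - a k) (n - k%:Z)) ->
  exists x, forall k, deg_le (x - a k) (n - k%:Z).
Proof.
move=> a0 aS; have stable k i m : n - k%:Z < m -> coef (a (k + i)%N) m = coef (a k) m.
  move=> km; elim: i => [|i IH]; first by rewrite addn0.
  have /eqP := aS (k + i)%N m ltac:(lia).
  by rewrite coefB subr_eq0 addnS => /eqP ->.
have an k m : n < m -> coef (a k) m = 0.
  by move=> nm; rewrite -(add0n k) stable ?a0 //; lia.
(* Coefficient [m] is final as soon as [n - k < m]; [`|n - m| + 1] is such a [k]. *)
have bx : (fun m => coef (a (absz (n - m)%R).+1) m) \in @bounded_above L.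
  by apply/asboolP; exists n => m /an.
exists (SkewLaurent s bx) => k m km; rewrite coefB /=.
have [nm|mn] := ltP n m; first by rewrite !an ?subrr.
apply/eqP; rewrite subr_eq0; apply/eqP.
pose j := (absz (n - m)%R).+1.
rewrite -[LHS](stable _ k); last by rewrite /j; lia.
by rewrite addnC stable.
Qed.

(** The iterates of [0] form a Cauchy sequence. A recursion that determines the
    coefficients of a series one after the other, in descending order, is solved
    by this lemma. *)
Lemma contraction_fixpoint (T : skew_laurent s -> skew_laurent s) :
    (forall x y n, deg_le (x - y) n -> deg_le (T x - T y) (n - 1)) ->
  exists x, T x = x.
Proof.
move=> Tc; have [n T0] := deg_le_ex (T 0).
have [||x xP] := @skew_limit (fun k => iter k T 0) n; first exact: deg_le0.
  elim=> [|k IH] /=; first by rewrite !subr0.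
  by have := Tc _ _ _ IH; have -> : n - k%:Z - 1 = n - k.+1%:Z by lia.
exists x; apply/eqP; rewrite -subr_eq0; apply/eqP.
apply: (@deg_le_eq0 _ (fun k => n - k.+1%:Z)) => [k|m]; last first.
  by exists (absz (n - m)); lia.
rewrite -(subrK (iter k.+1 T 0) (T x)) -addrA; apply: deg_leD.
  by have := Tc _ _ _ (xP k); have -> : n - k%:Z - 1 = n - k.+1%:Z by lia.
by rewrite -opprB; apply/deg_leN/xP.
Qed.

(** Up to a monomial factor [a = 1 - e] with [e] of negative degree, and the
    geometric series in [e] is the fixed point of [x |-> 1 + x e]. *)
Lemma skew_left_inverse a : a != 0 -> exists b, b * a = 1.
Proof.
move=> /is_deg_ex[d [ad aled]].
pose m := monomial s (aut_exp s (- d) (coef a d))^-1 (- d).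
pose e := 1 - m * a.
have ee : deg_le e (-1).
  move=> k k0; rewrite coefB coef_monomial_mul opprK.
  have [->|k1] := eqVneq k 0; first by rewrite coef_one add0r mulVf ?subrr // fmorph_eq0.
  by rewrite coef_one (negbTE k1) (aled (k + d)) ?rmorph0 ?mulr0 ?subr0 //; lia.
have [|x xE] := @contraction_fixpoint (fun x => 1 + x * e).
  by move=> x y n xy; rewrite addrAC opprD addrA subrr add0r addrC -mulrBl;
     apply: deg_leM.
exists (x * m); rewrite -mulrA (_ : m * a = 1 - e); last by rewrite /e subKr.
by rewrite mulrBr mulr1 -{1}xE addrK.
Qed.

(** The left inverse [b] of [a] has a left inverse in turn, which must be [a]. *)
Lemma skew_unitE a : (a \is a GRing.unit) = (a != 0).
Proof.
apply/idP/idP => [au|a0]; first by apply: contraTneq au => ->; rewrite unitr0.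
have [b ba] := skew_left_inverse a0.
have b0 : b != 0.
  by apply/eqP => b0; move: ba; rewrite b0 mul0r => /esym/eqP; rewrite oner_eq0.
have [c cb] := skew_left_inverse b0.
have ca : c = a by rewrite -[c]mulr1 -ba mulrA cb mul1r.
by apply/unitrP; exists b; rewrite -{2}ca.
Qed.

Lemma is_deg_unit a d : is_deg a d -> a \is a GRing.unit.
Proof. by move=> /is_deg_neq0; rewrite skew_unitE. Qed.

Lemma is_degV a d : is_deg a d -> is_deg a^-1 (- d).
Proof.
move=> ad; have au := is_deg_unit ad.
have [m am] : exists m, is_deg a^-1 m by apply: is_deg_ex; rewrite invr_neq0 ?(is_deg_neq0 ad).
have := is_degM am ad; rewrite mulVr // => /(is_deg_uniq is_deg1) h.
by have <- : m = - d by lia.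
Qed.

Lemma is_degXz a d k : is_deg a d -> is_deg (a ^ k) (k * d).
Proof.
move=> ad; have au := is_deg_unit ad.
elim/int_ind: k => [|k IH|k IH]; first by rewrite mul0r; exact: is_deg1.
  by rewrite intS mulrDl mul1r exprzDr //; apply: is_degM.
rewrite intS opprD mulrDl mulN1r exprzDr //; apply: is_degM => //.
exact: is_degV.
Qed.

End DegreeBounds.

(** * Bases of field extensions *)

Section FieldExtensions.

Lemma divring_closedP (R : unitRingType) (E : set R) :
  divring_closed (mem E) <->
  [/\ E 1, forall x y, E x -> E y -> E (x - y) & forall x y, E x -> E y -> E (x / y)].
Proof.
split=> [[h1 hB hD]|[h1 hB hD]]; split.
- by have := h1; rewrite inE.
- by move=> x y Ex Ey; have := hB x y; rewrite !inE => /(_ Ex Ey).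
- by move=> x y Ex Ey; have := hD x y; rewrite !inE => /(_ Ex Ey).
- by rewrite inE.
- by move=> x y; rewrite !inE; exact: hB.
- by move=> x y; rewrite !inE; exact: hD.
Qed.

Lemma adjoin_divring (R : unitRingType) (F : set R) (u : R) :
  divring_closed (mem (adjoin F u)).
Proof.
apply/divring_closedP; split.
- by move=> K [/divring_closedP[]].
- move=> x y Kx Ky K hK; have [/divring_closedP[_ KB _] _] := hK.
  exact: KB (Kx K hK) (Ky K hK).
- move=> x y Kx Ky K hK; have [/divring_closedP[_ _ KD] _] := hK.
  exact: KD (Kx K hK) (Ky K hK).
Qed.

Section Image.
Variables (K : fieldType) (R : unitRingType) (psi : {rmorphism K -> R}).
Implicit Types (F E B : set K).

Lemma divring_closed_image F :
  divring_closed (mem F) -> divring_closed (mem (psi @` F)).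
Proof.
move=> /divring_closedP[F1 FB FD]; apply/divring_closedP; split.
- by exists 1; rewrite ?rmorph1.
- by move=> _ _ [x Fx <-] [y Fy <-]; exists (x - y); rewrite ?rmorphB //; exact: FB.
- by move=> _ _ [x Fx <-] [y Fy <-]; exists (x / y); rewrite ?fmorph_div //; exact: FD.
Qed.

(** A morphism from a field commutes with division, hence images and preimages of
    division subrings are division subrings. *)
Lemma adjoin_image F u : adjoin (psi @` F) (psi u) = psi @` adjoin F u.
Proof.
apply/seteqP; split=> [y|_ [x Fux <-]].
  apply; split; first exact/divring_closed_image/adjoin_divring.
  by move=> _ [[x Fx <-]| ->]; [exists x | exists u] => // K' [_]; apply; [left|right].
move=> K' [/divring_closedP[K1 KB KD] FK'].
apply: (Fux (psi @^-1` K')); split; last first.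
  move=> z [Fz|->]; first by apply: FK'; left; exists z.
  by apply: FK'; right.
apply/divring_closedP; split; rewrite /preimage /=.
- by rewrite rmorph1.
- by move=> z t; rewrite rmorphB; exact: KB.
- by move=> z t; rewrite fmorph_div; exact: KD.
Qed.

Lemma is_subfield_image F : is_subfield F -> is_subfield (psi @` F).
Proof.
move=> [Fd FC]; split; first exact: divring_closed_image.
move=> a b; rewrite !inE => -[x Fx <-] [y Fy <-].
by rewrite -!rmorphM mulrC.
Qed.

(** The coefficients of a linear combination are given by a function on the whole
    ring, so they are carried along [psi] by means of a left inverse [g] of [psi]. *)
Lemma is_basis_image F E B :
  is_basis F E B -> is_basis (psi @` F) (psi @` E) (psi @` B).
Proof.
move=> [BE Espan Bfree].
pose g y := xget 0 [set x | psi x = y].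
have gK x : g (psi x) = x.
  by apply: xget_unique => // y /= /fmorph_inj.
have psiK y (A : set K) : (psi @` A) y -> psi (g y) = y /\ A (g y).
  by move=> [x Ax <-]; rewrite gK.
split.
- by move=> _ [x /BE Ex <-]; exists x.
- move=> _ [x /Espan[r [c [rB cF ->]]] <-]; exists (map psi r), (psi \o c \o g); split.
  + by move=> _ /mapP[b br ->]; exists b => //; apply: rB.
  + by move=> _ [y _ <-]; exists (c (g y)) => //; apply: cF; exists (g y).
  + by rewrite raddf_sum big_map; apply: eq_bigr => b _; rewrite /= gK rmorphM.
- move=> r c ru rB cF cr0 b br.
  have cK z : psi (g (c z)) = c z /\ F (g (c z)) by apply/psiK/cF; exists z.
  have rK : map psi (map g r) = r.
    by rewrite -map_comp -[RHS]map_id; apply/eq_in_map => z /rB/psiK[].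
  suff h : g (c (psi (g b))) = 0.
    by have [<- _] := cK b; rewrite -[b in c b](psiK b B (rB b br)).1 h rmorph0.
  apply: (Bfree (map g r) (fun z => g (c (psi z)))); last exact: map_f.
  + by rewrite -(map_inj_uniq (@fmorph_inj _ _ psi)) rK.
  + by move=> _ /mapP[z zr ->]; have [] := psiK z B (rB z zr).
  + by move=> _ [z _ <-]; have [] := cK (psi z).
  + apply: (@fmorph_inj _ _ psi); rewrite rmorph0 -cr0 -[in RHS]rK !big_map raddf_sum.
    by apply: eq_bigr => z _; rewrite /= rmorphM (cK _).1.
Qed.

Lemma has_ext_degree_image F E (T : Type) (D : set T) :
  has_ext_degree F E D -> has_ext_degree (psi @` F) (psi @` E) D.
Proof.
move=> [Fsub Esub FE [B Bb BD]]; split; [exact: is_subfield_image..| |].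
  by move=> _ [x Fx <-]; exists x => //; apply: FE.
exists (psi @` B); first exact: is_basis_image.
apply: card_eq_trans BD; apply: inj_card_eq => x y _ _; exact: fmorph_inj.
Qed.

End Image.

Definition lin_indep (K : fieldType) (F B : set K) :=
  forall (r : seq K) (c : K -> K), uniq r -> [set` r] `<=` B -> range c `<=` F ->
    \sum_(b <- r) c b * b = 0 -> {in r, forall b, c b = 0}.

(** Zorn's lemma for linearly independent sets. A finite family in the union of a
    chain lies in one member of the chain, so unions of chains are independent; and
    a vector outside the span of a maximal independent set could be added to it. *)
Lemma basis_exists (K : fieldType) (F : set K) :
  divring_closed (mem F) -> exists B, is_basis F [set: K] B.
Proof.
move=> /divring_closedP[F1 FB FD].
have F0 : F 0 by rewrite -(subrr 1); apply: FB.
have FN x : F x -> F (- x) by move=> Fx; rewrite -sub0r; apply: FB.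
have [|B [Bfree Bmax]] := @Zorn_bigcup _ (lin_indep F).
  move=> C Cfree Ctot r c ru rC cF cr0.
  suff [->//|[X CX rX]] : r = [::] \/ exists2 X, C X & [set` r] `<=` X.
    exact: (Cfree X CX).
  elim: r rC {ru cr0} => [|b r IH] rC; [by left|right].
  have [X CX Xb] : (\bigcup_(X in C) X) b by apply: rC; rewrite /= mem_head.
  have [|r0|[Y CY rY]] := IH; first by move=> z zr; apply: rC; rewrite /= in_cons zr orbT.
    by exists X => // z; rewrite r0 /= inE => /eqP ->.
  have [XY|YX] := Ctot X Y CX CY.
    by exists Y => // z; rewrite /= in_cons => /predU1P[->|/rY //]; apply: XY.
  by exists X => // z; rewrite /= in_cons => /predU1P[->//|/rY]; apply: YX.
exists B; split=> // x _; apply: contrapT => xspan.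
have Bx : ~ B x.
  move=> Bx; apply: xspan; exists [:: x], (fun=> 1); split.
  - by move=> z; rewrite /= inE => /eqP ->.
  - by move=> _ [_ _ <-].
  - by rewrite big_seq1 mul1r.
apply: (Bmax (B `|` [set x])).
  by split=> [|/(_ x)]; [exact: subsetUl | move=> h; apply/Bx/h; right].
move=> r c ru rB cF cr0.
have cFz z : F (c z) by apply: cF; exists z.
have rxB (z : K) : z \in rem x r -> B z.
  by rewrite mem_rem_uniq // inE => /andP[/eqP zx /rB[|/zx]].
(* Otherwise the relation could be solved for [x]. *)
have cx0 : x \in r -> c x = 0.
  move=> xr; apply: contrapT => /eqP cx; apply: xspan.
  exists (rem x r), (fun z => - (c z / c x)); split.
  - by move=> z /rxB.
  - by move=> _ [z _ <-]; apply/FN/FD.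
  - have := cr0; rewrite (perm_big _ (perm_to_rem xr)) big_cons /=.
    move=> /eqP; rewrite addr_eq0 => /eqP e; apply: (mulfI cx).
    by rewrite e -sumrN mulr_sumr; apply: eq_bigr => z _; rewrite mulNr mulrN mulrA mulrCA divff // mulr1.
have [xr|xr] := boolP (x \in r); last first.
  apply: (Bfree r) => // z zr; have [|zx] := rB z zr; first by [].
  by rewrite -(zx : z = x) zr in xr.
have h : {in rem x r, forall z, c z = 0}.
  apply: (Bfree (rem x r) c) => //; first exact: rem_uniq.
  by have := cr0; rewrite (perm_big _ (perm_to_rem xr)) big_cons /= cx0 // mul0r add0r.
move=> z zr; have [->|zx] := eqVneq z x; first exact: cx0.
by apply: h; rewrite mem_rem_uniq // inE zx.
Qed.

End FieldExtensions.

(** * Centralizers of constants and of series of degree zero *)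

Section Conjugation.
Variables (R : unitRingType) (w : R).
Hypothesis wu : w \is a GRing.unit.

Lemma conj_rmorphism (K : nzRingType) (h : {rmorphism K -> R}) :
  exists psi : {rmorphism K -> R}, forall x, psi x = w^-1 * h x * w.
Proof.
pose f x := w^-1 * h x * w.
have fz : zmod_morphism f by move=> x y; rewrite /f rmorphB mulrBr mulrBl.
have fm : monoid_morphism f.
  split; first by rewrite /f rmorph1 mulr1 mulVr.
  by move=> x y; rewrite /f rmorphM !mulrA mulrK.
pose f1 := GRing.isZmodMorphism.Build K R f fz.
pose f2 := GRing.isMonoidMorphism.Build K R f fm.
by exists (HB.pack_for {rmorphism K -> R} f f1 f2).
Qed.

Lemma conj_comm x c y : w * x = y * w ->
  GRing.comm c x -> GRing.comm (w * c * w^-1) y.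
Proof.
move=> wx cx; have -> : y = w * x * w^-1 by rewrite wx mulrK.
by rewrite /GRing.comm !mulrA !mulrVK // -(mulrA w c) -(mulrA w x) (cx : c * x = x * c).
Qed.

Lemma conj_mulK x : w^-1 * (w * x * w^-1) * w = x.
Proof. by rewrite !mulrA mulVr // mul1r mulrVK. Qed.
End Conjugation.

Section LeadingCoefficientNotFixed.
Variables (L : fieldType) (s : field_aut L).
Implicit Types (a b c u w : skew_laurent s) (l : L) (d j m n : int).

Lemma aut_exp_fixed l j : s l = l -> aut_exp s j l = l.
Proof.
move=> sl; elim/int_ind: j => [|n IH|n IH] //; first by rewrite intS aut_exp1z IH.
by rewrite intS opprD aut_expN1z IH -{1}sl autK.
Qed.

Lemma coef_constM l c n : coef (const s l * c) n = l * coef c n.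
Proof. by rewrite coef_monomial_mul subr0. Qed.

Lemma coef_Mconst l c n : coef (c * const s l) n = coef c n * aut_exp s n l.
Proof. by rewrite coef_mul_monomial subr0. Qed.

Lemma const_fixed_comm l c : s l = l -> GRing.comm c (const s l).
Proof.
move=> sl; apply: skewP => n.
by rewrite coef_Mconst coef_constM aut_exp_fixed // mulrC.
Qed.

Lemma comm_subr_const l c u :
  s l = l -> GRing.comm c u <-> GRing.comm c (u - const s l).
Proof.
move=> sl; have cl := const_fixed_comm c sl.
by split=> cu; [apply: commrB | rewrite -(subrK (const s l) u); apply: commrD].
Qed.

Variable s_free : forall l j, j != 0 -> aut_exp s j l = l -> s l = l.

(** In degree [n] the equation [c l = l c] says [c_n s^n(l) = l c_n]. *)
Lemma centralizer_const l :
  s l <> l -> centralizer (const s l) = range (const s).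
Proof.
move=> sl; apply/seteqP; split=> [c cl|_ [k _ <-]]; last first.
  by rewrite /centralizer /= /GRing.comm -!rmorphM mulrC.
exists (coef c 0) => //; apply: skewP => n; rewrite coef_monomial.
have [->//|n0] := eqVneq n 0.
have : coef (c * const s l) n = coef (const s l * c) n by rewrite (cl : c * _ = _).
rewrite coef_Mconst coef_constM mulrC => e.
have [->//|cn] := eqVneq (coef c n) 0.
by case: sl; apply: (s_free n0); apply: (mulIf cn).
Qed.

(** A series of degree [0] whose constant term [l] is moved by [s] is conjugate to
    [l]. Write [u = l + u'] with [deg u' < 0]. In degree [n < 0] the equation
    [w u = l w] says [(l - s^n(l)) w_n = (w u')_n], where the right hand side involves
    only coefficients [w_m] with [m > n], and where [l - s^n(l)] is invertible. *)
Lemma conj_const u : deg_le u 0 -> s (coef u 0) <> coef u 0 ->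
  exists w, [/\ is_deg w 0, coef w 0 = 1 & w * u = const s (coef u 0) * w].
Proof.
move=> ule; set l := coef u 0 => sl.
pose u' := u - const s l.
have u'le : deg_le u' (-1).
  move=> m m0; rewrite coefB coef_monomial; have [->|m1] := eqVneq m 0.
    by rewrite subrr.
  by rewrite ule ?subr0 //; lia.
pose Tc (w : skew_laurent s) n : L := if n == 0 then 1 else
  if n < 0 then coef (w * u') n / (l - aut_exp s n l) else 0.
have Tb w : Tc w \in @bounded_above L.
  by apply/asboolP; exists 0 => n n0; rewrite /Tc gt_eqF // ltNge ltW.
have [|w wE] := @contraction_fixpoint _ s (fun w => SkewLaurent s (Tb w)).
  move=> x y n xy m nm; rewrite coefB /= /Tc.
  case: eqVneq => [_|m0]; first by rewrite subrr.
  case: ltP => [mlt|_]; last by rewrite subrr.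
  by rewrite -mulrBl -coefB -mulrBl (deg_leM xy u'le) // mul0r.
have {}wE n : coef w n = Tc w n by rewrite -{1}wE.
have w0 : coef w 0 = 1 by rewrite wE.
have wle : deg_le w 0 by move=> m m0; rewrite wE /Tc gt_eqF // ltNge ltW.
exists w; split=> //; first by split=> //; rewrite w0 oner_neq0.
rewrite -{1}(subrK (const s l) u) mulrDr -/u'; apply: skewP => n.
rewrite coefD coef_Mconst coef_constM.
case: (ltgtP n 0) => [n0|n0|->].
- have ln : l - aut_exp s n l != 0.
    by rewrite subr_eq0; apply: contra_notN sl => /eqP e; apply: (s_free (j := n)); rewrite // lt_eqF.
  rewrite -(divfK ln (coef (w * u') n)).
  rewrite (_ : _ / _ = coef w n); last by rewrite [RHS]wE /Tc lt_eqF // n0.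
  by rewrite mulrBr subrK mulrC.
- by rewrite wle // (deg_leM wle u'le) ?mul0r ?mulr0 ?addr0 //; lia.
- by rewrite w0 mul1r mulr1 (deg_leM wle u'le) ?add0r.
Qed.

(** Conjugating by [w] as in [conj_const] carries [C(l) = L] to [C(u)], and since [w]
    has leading coefficient [1] it does not change constant terms. *)
Lemma centralizer_deg0 u : deg_le u 0 -> s (coef u 0) <> coef u 0 ->
  exists psi : {rmorphism L -> skew_laurent s},
    [/\ range psi = centralizer u, psi (coef u 0) = u,
        forall l, s l = l -> psi l = const s l,
        forall l, deg_le (psi l) 0 & forall l, coef (psi l) 0 = l].
Proof.
move=> ule sl; have [w [wdeg w0 wu]] := conj_const ule sl.
have wu' := is_deg_unit wdeg.
have [psi psiE] := conj_rmorphism wu' (const s).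
have Vdeg := is_degV wdeg; rewrite oppr0 in Vdeg.
have Vle := is_deg_le Vdeg; have wle := is_deg_le wdeg.
have V0 : coef w^-1 0 = 1.
  by have := coefM0 Vle wle; rewrite mulVr // w0 mulr1.
have cle l : deg_le (const s l) 0 by apply: deg_le_monomial.
have fu : psi (coef u 0) = u by rewrite psiE -mulrA -wu mulKr.
exists psi; split=> // [|l sl'|l|l].
- apply/seteqP; split=> [_ [l _ <-]|c cu].
    by rewrite /centralizer /= -[u]fu /GRing.comm -!(rmorphM psi) mulrC.
  have [l _ le] : range (const s) (w * c * w^-1).
    by rewrite -(centralizer_const sl); exact: (conj_comm wu' wu cu).
  by exists l => //; rewrite psiE /= le (conj_mulK wu').
- by rewrite psiE (const_fixed_comm w^-1 sl') mulrVK.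
- by rewrite psiE; apply: deg_leM0 (wle); apply: deg_leM0 (Vle) (cle l).
- rewrite psiE (coefM0 (deg_leM0 Vle (cle l)) wle) (coefM0 Vle (cle l)) V0 w0.
  by rewrite mul1r mulr1.
Qed.

(** All the claims hold for [L] in place of [C(u)] and are transported along the
    morphism [psi] of [centralizer_deg0], a section of [residue]. *)
Lemma centralizer_deg0_iso u : deg_le u 0 -> s (coef u 0) <> coef u 0 ->
  [/\ centralizer u `<=` nonpos_deg s,
      fixed_algebra_iso (centralizer u) residue,
      {in centralizer u &, commutative *%R}
    & exists D : set L,
        has_ext_degree (adjoin (fixed_consts s) u) (centralizer u) D /\
        has_ext_degree (adjoin (fixed_set s) (coef u 0)) [set: L] D].
Proof.
move=> ule sl; have [psi [psiC psiu psif psile psi0]] := centralizer_deg0 ule sl.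
have resK l : residue (psi l) = l by rewrite residueE //; exact/deg_leP/psile.
have fE : fixed_consts s = psi @` fixed_set s.
  by apply/seteqP; split=> _ [l ll <-]; exists l => //; rewrite psif.
rewrite -psiC; split.
- by move=> _ [l _ <-]; apply/deg_leP/psile.
- split.
  + split=> [|_ _ /set_mem[x _ <-] /set_mem[y _ <-]|_ _ /set_mem[x _ <-] /set_mem[y _ <-]].
    * by apply/mem_set; exists 1; rewrite ?rmorph1.
    * by apply/mem_set; exists (x - y); rewrite ?rmorphB.
    * by apply/mem_set; exists (x * y); rewrite ?rmorphM.
  + by rewrite fE => _ [l _ <-]; exists l.
  + split=> //.
      by move=> _ _ /set_mem[x _ <-] /set_mem[y _ <-]; rewrite !resK => ->.
    by move=> l _; exists (psi l).
  + split=> [|_ _ /set_mem[x _ <-] /set_mem[y _ <-]|_ _ /set_mem[x _ <-] /set_mem[y _ <-]|l _ sl' [x _ <-]].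
    * by rewrite -(rmorph1 psi).
    * by rewrite -rmorphD !resK.
    * by rewrite -rmorphM !resK.
    * by rewrite -psif // -rmorphM !resK.
- by move=> _ _ /set_mem[x _ <-] /set_mem[y _ <-]; rewrite -!rmorphM mulrC.
- have Fd := @adjoin_divring _ (fixed_set s) (coef u 0).
  have [B Bb] := basis_exists Fd; exists B.
  have h : has_ext_degree (adjoin (fixed_set s) (coef u 0)) [set: L] B.
    split=> //; last by exists B.
    + by split=> // x y _ _; rewrite mulrC.
    + split; last by move=> x y _ _; rewrite mulrC.
      by apply/divring_closedP.
  split=> //; rewrite fE -psiu adjoin_image; exact: has_ext_degree_image.
Qed.

End LeadingCoefficientNotFixed.

(** * Series with coefficients in the fixed field *)

Section FixedFieldSeries.
Variables (L : fieldType) (s : field_aut L).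

Fact fixed_val_zmod_morphism : zmod_morphism (@fixed_val L s).
Proof. by []. Qed.

Fact fixed_val_monoid_morphism : monoid_morphism (@fixed_val L s).
Proof. by []. Qed.

HB.instance Definition _ :=
  GRing.isZmodMorphism.Build (fixed_field s) L (@fixed_val L s) fixed_val_zmod_morphism.
HB.instance Definition _ :=
  GRing.isMonoidMorphism.Build (fixed_field s) L (@fixed_val L s)
    fixed_val_monoid_morphism.

Lemma fixed_valE (x : fixed_field s) : s (fixed_val x) = fixed_val x.
Proof. exact/eqP/(fixed_valP x). Qed.

End FixedFieldSeries.

Lemma id_aut_exp (K : fieldType) (j : int) (x : K) : aut_exp (id_aut K) j x = x.
Proof. exact: aut_exp_fixed. Qed.

Lemma laurent_mulC (K : fieldType) (f g : skew_laurent (id_aut K)) : f * g = g * f.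
Proof.
apply: skewP => n; rewrite !coefM (reindex_fsbigT (fun k => n - k)).
  by apply: eq_fsbigr => k _; rewrite !id_aut_exp subKr mulrC.
by exists (fun k => n - k) => k; rewrite subKr.
Qed.

Lemma finite_int_itv (a b : int) : finite_set [set k : int | a <= k <= b].
Proof.
apply: (@sub_finite_set _ _ ((fun k : nat => k%:Z + a) @` `I_(absz (b - a)).+1)).
  move=> k /= /andP[ak kb]; exists (absz (k - a)) => /=; lia.
exact/finite_image/finite_II.
Qed.

Section Series.
Variables (L : fieldType) (s : field_aut L).
Local Notation scalar_series := (skew_laurent (id_aut (fixed_field s))).
Implicit Types (f g : scalar_series) (a : skew_laurent s) (k m n : int).

(** The sums of [f k * w k] over all integers [k], for scalars [f k] in the fixed
    field that vanish for large [k]. Besides powers of a single series, [w] will be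
    a family that mixes the powers of two series. *)
Section Family.
Variables (w : int -> skew_laurent s) (e : int).
Hypotheses (e_gt0 : 0 < e) (w_le : forall k, deg_le (w k) (k * e)).

Let term f n k := fixed_val (coef f k) * coef (w k) n.

Lemma term0 f N n k : deg_le f N -> ~~ (- `|n| <= k <= N) -> term f n k = 0.
Proof.
move=> fN; rewrite negb_and -!ltNge => /orP[kn|/fN]; last first.
  by rewrite /term => ->; rewrite rmorph0 mul0r.
by rewrite /term w_le ?mulr0 //; nia.
Qed.

Lemma finite_term f n : finite_set [set k | term f n k != 0].
Proof.
have [N fN] := deg_le_ex f; apply: sub_finite_set (finite_int_itv (- `|n|) N).
by move=> k /=; apply: contraNT => /term0 ->.
Qed.

Lemma series_bounded_above f :
  (fun n => \sum_(k \in [set: int]) term f n k) \in @bounded_above L.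
Proof.
have [N fN] := deg_le_ex f; apply/asboolP; exists (N * e) => n Nn.
apply: fsbig1 => k _; rewrite /term; have [/fN ->|kN] := ltP N k.
  by rewrite rmorph0 mul0r.
by rewrite w_le ?mulr0 //; nia.
Qed.

Definition series f : skew_laurent s := SkewLaurent s (series_bounded_above f).

Lemma coef_series f n :
  coef (series f) n = \sum_(k \in [set: int]) fixed_val (coef f k) * coef (w k) n.
Proof. by []. Qed.

Lemma coef_series_itv f N n : deg_le f N ->
  coef (series f) n = \sum_(k \in [set k | - `|n| <= k <= N]) term f n k.
Proof.
by move=> fN; apply/esym/fsbig_widen => // k [_ /= /negP]; exact: term0.
Qed.

Lemma series_zmod_morphism : zmod_morphism series.
Proof.
move=> f g; apply: skewP => n.
have [N fN] := deg_le_ex f; have [M gM] := deg_le_ex g.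
have {}fN : deg_le f (Num.max N M) by apply: deg_leW fN; rewrite le_max lexx.
have {}gM : deg_le g (Num.max N M) by apply: deg_leW gM; rewrite le_max lexx orbT.
rewrite coefB (coef_series_itv n fN) (coef_series_itv n gM).
rewrite (coef_series_itv n (deg_leB fN gM)).
rewrite !fsbig_finite /=; try exact: finite_int_itv.
rewrite -sumrB.
by apply: eq_bigr => k _; rewrite /term coefB rmorphB mulrBl.
Qed.

HB.instance Definition _ :=
  GRing.isZmodMorphism.Build scalar_series (skew_laurent s) series series_zmod_morphism.

Lemma seriesD f g : series (f + g) = series f + series g.
Proof. exact: raddfD. Qed.

Lemma seriesB f g : series (f - g) = series f - series g.
Proof. exact: raddfB. Qed.

Lemma series_le f N : deg_le f N -> deg_le (series f) (N * e).
Proof.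
move=> fN n Nn; apply: fsbig1 => k _; rewrite /term; have [/fN ->|kN] := ltP N k.
  by rewrite rmorph0 mul0r.
by rewrite w_le ?mulr0 //; nia.
Qed.

Lemma series_monomial x k : series (monomial _ x k) = const s (fixed_val x) * w k.
Proof.
apply: skewP => n; rewrite coef_constM coef_series -(fsbig_widen [set k]) //.
  by rewrite fsbig_set1 coef_monomial eqxx.
by move=> j [_ /eqP /= /negbTE jk]; rewrite /= jk rmorph0 mul0r.
Qed.

(** No cancellation can occur in degree [N e]: only [w N] reaches it. *)
Lemma is_deg_series f N :
  (forall k, is_deg (w k) (k * e)) -> is_deg f N -> is_deg (series f) (N * e).
Proof.
move=> wdeg [fN0 fN]; split; last exact: series_le.
rewrite -(subrK (monomial _ (coef f N) N) f) seriesD coefD.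
have f'N : deg_le (f - monomial _ (coef f N) N) (N - 1).
  move=> k Nk; rewrite coefB coef_monomial; case: eqVneq => [->|kN].
    by rewrite subrr.
  by rewrite fN ?subr0 //; lia.
rewrite (series_le f'N) ?add0r; last by nia.
rewrite series_monomial coef_constM mulf_neq0 //; last by case: (wdeg N).
Qed.

Lemma series_inj : (forall k, is_deg (w k) (k * e)) -> injective series.
Proof.
move=> wdeg f g fg; apply/eqP; rewrite -subr_eq0; apply/negPn/negP.
move=> /is_deg_ex[N /(is_deg_series wdeg) /is_deg_neq0].
by rewrite seriesB fg subrr eqxx.
Qed.

End Family.

(** Identities between continuous additive operations on series need only be checked
    on monomials: stripping leading monomials off [f] leaves [D f] unchanged and
    lowers its degree without bound. *)
Lemma series_morph_eq0 (D : scalar_series -> skew_laurent s) (e M : int) :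
    0 < e -> zmod_morphism D ->
    (forall f N, deg_le f N -> deg_le (D f) (N * e + M)) ->
    (forall x k, D (monomial _ x k) = 0) ->
  forall f, D f = 0.
Proof.
move=> e0 DB Dle Dmon f; have [N fN] := deg_le_ex f.
have step (j : nat) : exists2 g, deg_le g (N - j%:Z) & D f = D g.
  elim: j => [|j [g gN ->]]; first by exists f; rewrite ?subr0.
  exists (g - monomial _ (coef g (N - j%:Z)) (N - j%:Z)); last by rewrite DB Dmon subr0.
  move=> k Nk; rewrite coefB coef_monomial; case: eqVneq => [->|kN].
    by rewrite subrr.
  by rewrite gN ?subr0 //; lia.
apply: (@deg_le_eq0 _ _ _ (fun j : nat => (N - j%:Z) * e + M)) => [j|m].
  by have [g gN ->] := step j; apply: Dle.
by exists (absz (`|N * e + M| + `|m| + 1)); nia.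
Qed.

Lemma series_comm w e (e0 : 0 < e) (w_le : forall k, deg_le (w k) (k * e)) a f :
  (forall k, GRing.comm (w k) a) -> GRing.comm (series e0 w_le f) a.
Proof.
move=> wa; apply/eqP; rewrite -subr_eq0; apply/eqP.
have [M aM] := deg_le_ex a.
apply: (@series_morph_eq0 (fun f => series e0 w_le f * a - a * series e0 w_le f) e M) => //.
- move=> x y; rewrite seriesB mulrBl mulrBr !opprB addrACA [RHS]addrACA.
  by rewrite [- _ - _]addrC.
- move=> g N gN; have sN := series_le e0 w_le gN.
  by apply: deg_leB; [|rewrite addrC]; apply: deg_leM.
- move=> x k; rewrite series_monomial -mulrA (wa k : _ * _ = _ * _) !mulrA.
  by rewrite (const_fixed_comm a (fixed_valE x) : a * _ = _ * _) subrr.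
Qed.

Section Powers.
Variables (v : skew_laurent s) (e : int).
Hypotheses (e_gt0 : 0 < e) (v_deg : is_deg v e).

Lemma exprz_le k : deg_le (v ^ k) (k * e).
Proof. exact/is_deg_le/is_degXz. Qed.

Definition power_series := series e_gt0 exprz_le.

Lemma power_series_monomial x k :
  power_series (monomial _ x k) = const s (fixed_val x) * v ^ k.
Proof. exact: series_monomial. Qed.

(** Both sides are additive and continuous in each of the two factors, and on
    monomials the claim is the law of exponents, because scalars of the fixed field
    are central. *)
Lemma power_series_monoid_morphism : monoid_morphism power_series.
Proof.
have vu := is_deg_unit v_deg.
have psB : zmod_morphism power_series by exact: series_zmod_morphism.
split=> [|f g]; first by rewrite [LHS]power_series_monomial rmorph1 mul1r expr0z.
have mono x k h : power_series (monomial _ x k * h) =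
    power_series (monomial _ x k) * power_series h.
  apply/eqP; rewrite -subr_eq0; apply/eqP.
  pose D h := power_series (monomial _ x k * h) -
    power_series (monomial _ x k) * power_series h.
  apply: (@series_morph_eq0 D e (k * e)) => //.
  - move=> a b; rewrite /D mulrBr !psB mulrBr !opprB addrACA [RHS]addrACA.
    by rewrite [- _ - _]addrC.
  - move=> a N aN; have xk := @deg_le_monomial _ (id_aut (fixed_field s)) x k.
    rewrite addrC; apply: deg_leB; first by rewrite -mulrDl; apply/series_le/deg_leM.
    by apply: deg_leM; apply: series_le.
  - move=> y j; rewrite /D monomialM id_aut_exp !power_series_monomial rmorphM exprzDr //.
    rewrite /= !mulrA -(mulrA (const s (fixed_val x)) (v ^ k)).
    rewrite (const_fixed_comm (v ^ k) (fixed_valE y) : _ * const s _ = _).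
    by rewrite !mulrA subrr.
have [M gM] := deg_le_ex g.
apply/eqP; rewrite -subr_eq0; apply/eqP.
pose D h := power_series (h * g) - power_series h * power_series g.
apply: (@series_morph_eq0 D e (M * e)) => //.
- move=> a b; rewrite /D mulrBl !psB mulrBl !opprB addrACA [RHS]addrACA.
  by rewrite [- _ - _]addrC.
- move=> a N aN; apply: deg_leB; first by rewrite -mulrDl; apply/series_le/deg_leM.
  by apply: deg_leM; apply: series_le.
- by move=> x k; rewrite /D mono subrr.
Qed.

HB.instance Definition _ :=
  GRing.isZmodMorphism.Build scalar_series (skew_laurent s) power_series
    (series_zmod_morphism e_gt0 exprz_le).
HB.instance Definition _ :=
  GRing.isMonoidMorphism.Build scalar_series (skew_laurent s) power_series
    power_series_monoid_morphism.

Lemma power_series_is_series f : is_series v (coef f) (power_series f).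
Proof. by move=> n; split=> //; exact: (finite_term e_gt0 exprz_le). Qed.

Lemma series_inE : series_in v = range power_series.
Proof.
apply/seteqP; split=> [a [f [fsum _] fa]|_ [f _ <-]].
  have [N fN] : exists N : int, forall i, N < i -> f i = 0.
    by apply: fsum; rewrite (degE v_deg) lte_fin.
  have fb : f \in @bounded_above (fixed_field s) by apply/asboolP; exists N.
  by exists (SkewLaurent _ fb) => //; apply: skewP => n; rewrite coef_series (fa n).2.
exists (coef f); last exact: power_series_is_series.
split; first by move=> _; exact: deg_le_ex.
by rewrite (degE v_deg) lte_fin ltNge ltW.
Qed.

End Powers.
End Series.

(** * Centralizers of series of nonzero degree *)

Section Centralizer.
Variables (L : fieldType) (s : field_aut L).
Implicit Types (a b c u v : skew_laurent s) (d e k m n : int).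

Lemma centralizer1 u : centralizer u 1.
Proof. exact/commr_sym/commr1. Qed.

Lemma centralizerB u a b : centralizer u a -> centralizer u b -> centralizer u (a - b).
Proof. by move=> au bu; apply/commr_sym/commrB; apply: commr_sym. Qed.

Lemma centralizerM u a b : centralizer u a -> centralizer u b -> centralizer u (a * b).
Proof. by move=> au bu; apply/commr_sym/commrM; apply: commr_sym. Qed.

Lemma centralizerV u a : centralizer u a -> centralizer u a^-1.
Proof. by move=> au; apply/commr_sym/commrV/commr_sym. Qed.

Lemma centralizerXz u a k : centralizer u a -> centralizer u (a ^ k).
Proof. by move=> au; apply/commr_sym/commrXz/commr_sym. Qed.

Lemma centralizer_divring u : divring_closed (mem (centralizer u)).
Proof.
apply/divring_closedP; split; [exact: centralizer1 | exact: centralizerB|].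
by move=> a b au bu; apply/centralizerM/centralizerV.
Qed.

Lemma centralizer_inv u : u \is a GRing.unit -> centralizer u^-1 = centralizer u.
Proof.
move=> uu; apply/seteqP; split=> c cu; last exact: commrV.
by rewrite -(invrK u); apply: commrV.
Qed.

(** Replace the index [i] by [-i]. *)
Lemma series_in_inv_sub u d : is_deg u d -> series_in u `<=` series_in u^-1.
Proof.
move=> ud a [f [fpos fneg] fa]; exists (fun i => f (- i)); last first.
  move=> n; have [fin aE] := fa n; split; last first.
    rewrite aE (reindex_fsbigT (fun i : int => - i)).
      by apply: eq_fsbigr => i _; rewrite exprz_inv.
    by exists (fun i => - i) => i; rewrite opprK.
  apply: sub_finite_set (finite_image (fun i : int => - i) fin) => i /= fi.
  by exists (- i); rewrite ?opprK // -exprz_inv.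
rewrite /summable (degE (is_degV ud)) !lte_fin oppr_gt0 oppr_lt0.
rewrite (degE ud) !lte_fin in fpos fneg.
split=> [/fneg[N fN]|/fpos[N fN]]; exists (- N) => i iN; apply: fN; lia.
Qed.

Lemma series_in_inv u d : is_deg u d -> series_in u^-1 = series_in u.
Proof.
move=> ud; apply/seteqP; split; last exact: series_in_inv_sub ud.
by rewrite -{2}(invrK u); apply: series_in_inv_sub (is_degV ud).
Qed.

(** Terms of pairwise distinct degrees cannot cancel: the sum has the degree of one of
    its nonzero terms, if there are any. *)
Lemma sum_distinct_degs (T : eqType) (r : seq T) (F : T -> skew_laurent s) :
    uniq r ->
    {in r &, forall x y n, is_deg (F x) n -> is_deg (F y) n -> x = y} ->
    \sum_(x <- r) F x = 0 ->
  {in r, forall x, F x = 0}.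
Proof.
move=> ru Finj sum0.
suff [//|[x xr [n xn]]] : {in r, forall x, F x = 0} \/
    exists2 x, x \in r & exists n, is_deg (F x) n /\ is_deg (\sum_(x <- r) F x) n.
  by case: xn => _; rewrite sum0 => /is_deg_neq0; rewrite eqxx.
elim: r ru Finj {sum0} => [|x r IH]; first by left.
move=> /= /andP[xr ru] Finj.
have [|F0|[y yr [n [yn sn]]]] := IH ru.
- by move=> y z yr zr; apply: Finj; rewrite in_cons ?yr ?zr orbT.
- have [Fx0|/is_deg_ex[n xn]] := eqVneq (F x) 0.
    by left=> y; rewrite in_cons => /predU1P[->|/F0].
  right; exists x; rewrite ?mem_head //; exists n; split=> //.
  by rewrite big_cons big_seq big1 ?addr0.
- right; rewrite big_cons.
  have [Fx0|/is_deg_ex[m xm]] := eqVneq (F x) 0.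
    by exists y; [rewrite in_cons yr orbT | exists n; rewrite Fx0 add0r].
  have [nm|mn|nm] := ltgtP n m.
  + exists x; [exact: mem_head | exists m; split=> //].
    split; first by rewrite coefD (sn.2 _ nm) addr0; case: xm.
    by apply: deg_leD; [case: xm | apply: deg_leW (ltW nm) sn.2].
  + exists y; [by rewrite in_cons yr orbT | exists n; split=> //].
    split; first by rewrite coefD (xm.2 _ mn) add0r; case: sn.
    by apply: deg_leD; [apply: deg_leW (ltW mn) xm.2 | case: sn].
  + rewrite nm in yn; move: xr; rewrite (Finj x y _ _ m) ?yr //.
      exact: mem_head.
    by rewrite in_cons yr orbT.
Qed.

(** If [m = q e + r] is the division of [m = deg a] by [e = deg v], then [a v^(-q)] is
    an element of degree [r < e] of the centralizer, whence [r = 0]. *)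
Lemma least_pos_degP u v : least_pos_deg (centralizer u) v ->
  exists e, [/\ centralizer u v, is_deg v e, 0 < e &
    forall a m, centralizer u a -> is_deg a m -> exists q, m = q * e].
Proof.
move=> [vu v0 vmin].
have [v00|/is_deg_ex[e ve]] := eqVneq v 0; first by rewrite v00 deg0 in v0.
rewrite (degE ve) lte_fin in v0; exists e; split=> // a m au am.
exists (m %/ e)%Z; pose r := (m %% e)%Z.
have [r0 re] : 0 <= r /\ r < e by rewrite modz_ge0 ?ltz_pmod // gt_eqF.
have mE := divz_eq m e; rewrite -/r in mE.
suff r00 : r = 0 by rewrite r00 addr0 in mE.
have := vmin (a * v ^ (- (m %/ e)%Z)).
have -> : deg (a * v ^ (- (m %/ e)%Z)) = r%:E.
  by apply: degE; rewrite (_ : r = m + - (m %/ e)%Z * e); [apply/is_degM/is_degXz | lia].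
rewrite (degE ve) lte_fin lee_fin => h.
have {}h := h (centralizerM au (centralizerXz _ vu)); lia.
Qed.

Variable s_free : forall (l : L) k, k != 0 -> aut_exp s k l = l -> s l = l.

Section NonzeroDegree.
Variables (u : skew_laurent s) (d : int).
Hypotheses (u_deg : is_deg u d) (d_neq0 : d != 0).

(** Comparing leading coefficients in [a u = u a] gives
    [s^d(a_m) = a_m * (s^m(u_d) / u_d)]. The second factor depends on [m] only, so the
    ratio of two such leading coefficients is fixed by [s^d], hence by [s]. *)
Lemma leading_ratio_fixed a b m : centralizer u a -> centralizer u b ->
  deg_le a m -> is_deg b m -> s (coef a m / coef b m) = coef a m / coef b m.
Proof.
move=> au bu am [b0 bm]; have [ud0 ud] := u_deg; apply: (s_free d_neq0).
have eq c : centralizer u c -> deg_le c m ->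
    aut_exp s d (coef c m) = coef c m * (aut_exp s m (coef u d) / coef u d).
  move=> cu cm; apply: (mulIf ud0); rewrite mulrA divfK // -(coefM_top cm ud).
  by rewrite (cu : c * u = u * c) addrC (coefM_top ud cm) mulrC.
rewrite fmorph_div /= !eq // invfM mulrACA divff ?mulr1 //.
by rewrite mulf_neq0 ?invr_neq0 ?fmorph_eq0.
Qed.

Lemma least_pos_deg_exists : exists v, least_pos_deg (centralizer u) v.
Proof.
pose P (j : nat) := `[< exists2 c, centralizer u c & is_deg c j.+1%:Z >].
have exP : exists j, P j.
  have uC : centralizer u u by [].
  case: (ltgtP d 0) d_neq0 => // d0 _; exists (absz d).-1; apply/asboolP.
    exists u^-1; first exact: centralizerV.
    by rewrite (_ : _%:Z = - d); [exact: is_degV | lia].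
  by exists u => //; rewrite (_ : _%:Z = d) //; lia.
have [j /asboolP[v vu vj] jmin] := ex_minnP exP.
exists v; split=> //; first by rewrite (degE vj) lte_fin.
move=> a au; have [->|/is_deg_ex[m am]] := eqVneq a 0; first by rewrite deg0.
rewrite (degE am) (degE vj) lte_fin lee_fin => m0.
suff : (j <= (absz m).-1)%N by lia.
apply: jmin; apply/asboolP; exists a => //.
by rewrite (_ : _%:Z = m) //; lia.
Qed.

Section Generator.
Variables (v : skew_laurent s) (e : int).
Hypotheses (vC : centralizer u v) (v_deg : is_deg v e) (e_gt0 : 0 < e).
Hypothesis C_deg : forall a m, centralizer u a -> is_deg a m -> exists q, m = q * e.

(** Successive approximation. If [c] in [C(u)] has degree at most [k e], then the ratio
    of its coefficient there to that of [w k] is a fixed scalar; subtracting the scalar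
    multiple of [w k] gives an element of [C(u)] of smaller degree, so of degree at most
    [(k - 1) e]. *)
Lemma centralizer_expansion (w : int -> skew_laurent s)
    (w_le : forall k, deg_le (w k) (k * e)) :
    (forall k, is_deg (w k) (k * e)) -> (forall k, centralizer u (w k)) ->
  centralizer u = range (series e_gt0 w_le).
Proof.
move=> wdeg wC; have serC f : centralizer u (series e_gt0 w_le f) by exact: series_comm.
apply/seteqP; split=> [c cC|_ [f _ <-]//].
(* The default [0] of [insubd] is not reached on [C(u)], where the ratio is fixed. *)
pose lam (a : skew_laurent s) k : fixed_field s :=
  insubd 0 (coef a (k * e) / coef (w k) (k * e)).
have lamE a k : centralizer u a -> deg_le a (k * e) ->
    deg_le (a - const s (fixed_val (lam a k)) * w k) ((k - 1) * e).
  move=> aC ak; set b := _ - _.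
  have lE : fixed_val (lam a k) = coef a (k * e) / coef (w k) (k * e).
    by rewrite /lam insubdK //; apply/eqP/leading_ratio_fixed.
  have bC : centralizer u b.
    apply: centralizerB => //; apply: centralizerM => //.
    exact/commr_sym/const_fixed_comm/fixed_valE.
  have bk : deg_le b (k * e).
    apply: deg_leB => //; rewrite -[k * e]add0r; apply: deg_leM; last by case: (wdeg k).
    exact: deg_le_monomial.
  have b0 : coef b (k * e) = 0.
    by rewrite coefB coef_constM lE divfK ?subrr //; case: (wdeg k).
  have [->|/is_deg_ex[m bm]] := eqVneq b 0; first exact: deg_le0.
  have [q mE] := C_deg bC bm.
  apply: deg_leW (is_deg_le bm).
  have mk : m <= k * e by rewrite leNgt; apply/negP => /bk bm0; case: bm; rewrite bm0 eqxx.
  have qk : q != k by apply: contraTneq isT => qk; case: bm; rewrite mE qk b0 eqxx.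
  by move: mk; rewrite mE !ler_pM2r //; lia.
have [n cn] := deg_le_ex c; pose N : int := `|n|.
pose next (j : nat) (f : skew_laurent (id_aut (fixed_field s))) :=
  f + monomial _ (lam (c - series e_gt0 w_le f) (N - j%:Z)) (N - j%:Z).
pose a := fix a j := if j is j'.+1 then next j' (a j') else 0.
have inv j : deg_le (c - series e_gt0 w_le (a j)) ((N - j%:Z) * e).
  elim: j => [|j IH] /=.
    by rewrite raddf0 !subr0; apply: deg_leW cn; rewrite /N; nia.
  rewrite /next seriesD opprD addrA series_monomial.
  rewrite (_ : N - j.+1%:Z = N - j%:Z - 1); last by lia.
  exact/lamE/IH/centralizerB.
have [||f fP] := @skew_limit _ _ a N; first exact: deg_le0.
  by move=> j; rewrite /= /next addrAC subrr add0r; apply: deg_le_monomial.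
exists f => //; apply/esym/eqP; rewrite -subr_eq0; apply/eqP.
apply: (@deg_le_eq0 _ _ _ (fun j : nat => (N - j%:Z) * e)) => [j|m].
  rewrite -(subrK (series e_gt0 w_le (a j)) c) -addrA; apply: deg_leD => //.
  by rewrite -opprB -seriesB; apply/deg_leN/series_le.
by exists (absz (`|N| + `|m| + 1)); nia.
Qed.

Lemma centralizer_power_series : centralizer u = range (power_series e_gt0 v_deg).
Proof.
by apply: centralizer_expansion => k; [exact: is_degXz | exact: centralizerXz].
Qed.

Lemma centralizer_commutative : {in centralizer u &, commutative *%R}.
Proof.
rewrite centralizer_power_series => _ _ /set_mem[f _ <-] /set_mem[g _ <-].
by rewrite -!rmorphM laurent_mulC.
Qed.

(** Here the expansion is applied to the family of the powers of [v]. *)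
Lemma centralizer_laurent :
  centralizer u = series_in v /\ laurent_series_field_in v (centralizer u).
Proof.
rewrite (series_inE e_gt0 v_deg) -centralizer_power_series; split=> //.
exists (power_series e_gt0 v_deg); split.
- by apply: series_inj => k; apply: is_degXz.
- by rewrite centralizer_power_series.
- by move=> f; apply: power_series_is_series.
Qed.

End Generator.
End NonzeroDegree.

Section ResidueClasses.
Variable n : nat.
Hypothesis n_gt0 : (0 < n)%N.
Local Notation scalar_series := (skew_laurent (id_aut (fixed_field s))).

Lemma section_bounded_above (f : scalar_series) (j : int) :
  (fun i => coef f (i * n%:Z + j)) \in @bounded_above (fixed_field s).
Proof.
have [N fN] := deg_le_ex f; apply/asboolP; exists (`|N| + `|j|) => i iN.
by apply: fN; nia.
Qed.

(** The part of [f] on the indices congruent to [j] modulo [n], as a series in the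
    [n]-th power of the variable. *)
Definition series_section (f : scalar_series) j : scalar_series :=
  SkewLaurent (id_aut (fixed_field s)) (section_bounded_above f j).

End ResidueClasses.

Section ExtensionDegree.
Variables (u v : skew_laurent s) (e : int) (n : nat).
Hypotheses (e_gt0 : 0 < e) (n_gt0 : (0 < n)%N).
Hypotheses (u_deg : is_deg u (n%:Z * e)) (vC : centralizer u v) (v_deg : is_deg v e).
Hypothesis C_deg : forall a m, centralizer u a -> is_deg a m -> exists q, m = q * e.

Let d_gt0 : 0 < n%:Z * e. Proof. by rewrite mulr_gt0 // ltz_nat. Qed.
Let d_neq0 : n%:Z * e != 0. Proof. by rewrite gt_eqF. Qed.
Local Notation su := (power_series d_gt0 u_deg).

(** One product [u^i v^j] with [0 <= j < n] for each multiple [k e] of [e], where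
    [k = i n + j]. *)
Let w (k : int) := u ^ (k %/ n%:Z)%Z * v ^ (k %% n%:Z)%Z.

Let w_deg k : is_deg (w k) (k * e).
Proof.
rewrite {2}(divz_eq k n%:Z) mulrDl -mulrA.
by apply: is_degM; apply: is_degXz.
Qed.

Let w_le k : deg_le (w k) (k * e). Proof. exact: is_deg_le. Qed.

(** Sorting the terms [u^i v^j] by the exponent [j] shows that the powers [v^j],
    [j < n], span. *)
Lemma series_interleave f :
  series e_gt0 w_le f = \sum_(j < n) su (series_section n_gt0 f j%:Z) * v ^+ j.
Proof.
apply/eqP; rewrite -subr_eq0; apply/eqP.
pose D f := series e_gt0 w_le f - \sum_(j < n) su (series_section n_gt0 f j%:Z) * v ^+ j.
apply: (@series_morph_eq0 _ _ D e 0) => //.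
- move=> x y; rewrite /D seriesB [in RHS]opprD opprK [RHS]addrACA; congr (_ + _).
  rewrite -!sumrN -big_split /=; apply: eq_bigr => j _.
  have -> : series_section n_gt0 (x - y) j%:Z = series_section n_gt0 x j%:Z - series_section n_gt0 y j%:Z.
    exact: skewP.
  by rewrite rmorphB mulrBl opprB addrC.
- move=> g N gN; rewrite addr0; apply: deg_leB; first exact: series_le.
  elim/big_ind: _ => [||j _]; [exact: deg_le0 | by move=> *; apply: deg_leD |].
  have vj : deg_le (v ^+ j) (j%:Z * e) by rewrite exprnP; apply: exprz_le.
  pose M := ((N - j%:Z) %/ n%:Z)%Z.
  have sM : deg_le (series_section n_gt0 g j%:Z) M.
    by move=> i iM; apply: gN; rewrite /M in iM; nia.
  apply: deg_leW (deg_leM (series_le d_gt0 _ sM) vj).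
  by rewrite mulrA -mulrDl ler_pM2r // /M; nia.
- move=> x k; rewrite /D series_monomial.
  have kn : (absz (k %% n%:Z)%Z < n)%N by lia.
  pose j0 := Ordinal kn.
  have j0E : j0%:Z = (k %% n%:Z)%Z by rewrite /=; lia.
  rewrite (bigD1 j0) //= big1 ?addr0 => [|j jj0].
    have -> : series_section n_gt0 (monomial (id_aut (fixed_field s)) x k) j0%:Z =
        monomial _ x (k %/ n%:Z)%Z.
      apply: skewP => i; rewrite /= j0E; congr (if _ then _ else _).
      by apply/eqP/eqP; nia.
    rewrite power_series_monomial /w -mulrA -j0E; apply/eqP; rewrite subr_eq0.
    by rewrite mulrA.
  have -> : series_section n_gt0 (monomial (id_aut (fixed_field s)) x k) j%:Z = 0.
    apply: skewP => i; rewrite /= ifF //; apply/eqP => ik.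
    move/eqP: jj0; apply; apply: val_inj => /=.
    by rewrite -ik modzMDl modz_small // ltz_nat ltn_ord.
  by rewrite rmorph0 mul0r.
Qed.

Lemma series_in_subfield : is_subfield (series_in u).
Proof.
rewrite (series_inE d_gt0 u_deg); split.
  apply/divring_closedP; split.
  - by exists 1; rewrite ?rmorph1.
  - by move=> _ _ [f _ <-] [g _ <-]; exists (f - g); rewrite ?rmorphB.
  - move=> _ _ [f _ <-] [g _ <-]; exists (f / g) => //.
    have [->|g0] := eqVneq g 0; first by rewrite invr0 !rmorph0 invr0 mulr0 rmorph0 mulr0.
    by rewrite rmorph_div ?skew_unitE.
by move=> _ _ /set_mem[f _ <-] /set_mem[g _ <-]; rewrite -!rmorphM laurent_mulC.
Qed.

(** The basis consists of the powers [v^j], [j < n]. It spans by [series_interleave].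
    It is independent because a nonzero series in [u] times [v^j] has a degree congruent
    to [j e] modulo [n e], so that [sum_distinct_degs] applies. *)
Lemma centralizer_ext_degree : has_ext_degree (series_in u) (centralizer u) `I_n.
Proof.
have v_inj (j k : nat) : v ^+ j = v ^+ k -> j = k.
  move=> jk; have := is_degXz k%:Z v_deg; rewrite -exprnP -jk => kdeg.
  have := is_deg_uniq (is_degXz j%:Z v_deg) kdeg; nia.
split; first exact: series_in_subfield.
- split; first exact: centralizer_divring.
  exact: (centralizer_commutative u_deg d_neq0 vC v_deg e_gt0 C_deg).
- rewrite (series_inE d_gt0 u_deg) => _ [f _ <-].
  by apply: series_comm => k; apply: centralizerXz.
exists ((fun j => v ^+ j) @` `I_n); last by apply: inj_card_eq => j k _ _; apply: v_inj.
split.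
- by move=> _ [j _ <-]; apply: (centralizerXz j%:Z vC).
- move=> c; rewrite (centralizer_expansion u_deg d_neq0 e_gt0 C_deg w_le) //; last first.
    by move=> k; apply: centralizerM; apply: centralizerXz.
  move=> [f _ <-]; exists [seq v ^+ val j | j <- enum 'I_n].
  (* The exponent [j] is recovered from the basis element [v^j] by its degree. *)
  exists (fun b => su (series_section n_gt0 f (fine (deg b) %/ e)%Z)); split.
  + by move=> _ /mapP[j _ ->]; exists (val j) => //=.
  + by rewrite (series_inE d_gt0 u_deg) => _ [b _ <-]; eexists.
  + rewrite series_interleave big_map big_enum; apply: eq_bigr => j _.
    rewrite (degE (is_degXz j%:Z v_deg)) /= mulzK //.
    by rewrite gt_eqF.
- move=> r c ru rB cF c0 b br.
  have cdeg x : c x != 0 -> exists m, is_deg (c x) (m * (n%:Z * e)).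
    move=> cx; have : series_in u (c x) by apply: cF; exists x.
    rewrite (series_inE d_gt0 u_deg) => -[f _ fE]; rewrite -fE in cx *.
    have f0 : f != 0 by apply: contra_neq cx => ->; rewrite rmorph0.
    have [m fm] := is_deg_ex f0; exists m.
    exact: (is_deg_series d_gt0 _ (fun k => is_degXz k u_deg) fm).
  suff : c b * b = 0.
    move=> /eqP; have [j _ <-] := rB _ br.
    have vu : v ^+ j \is a GRing.unit by apply: (is_deg_unit (is_degXz j%:Z v_deg)).
    by move=> /eqP cb; rewrite -(mulrK vu (c _)) cb mul0r.
  apply: (sum_distinct_degs (F := fun b => c b * b) ru _ c0 br) => x y xr yr m xm ym.
  have /cdeg[p xp] : c x != 0.
    by apply: contraTneq isT => cx0; have := is_deg_neq0 xm; rewrite cx0 mul0r eqxx.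
  have /cdeg[q yq] : c y != 0.
    by apply: contraTneq isT => cy0; have := is_deg_neq0 ym; rewrite cy0 mul0r eqxx.
  have [j /= jn jx] := rB _ xr; have [k /= kn ky] := rB _ yr.
  rewrite -jx in xp xm *; rewrite -ky in yq ym *.
  have xE := is_deg_uniq xm (is_degM xp (is_degXz j%:Z v_deg)).
  have yE := is_deg_uniq ym (is_degM yq (is_degXz k%:Z v_deg)).
  congr (_ ^+ _).
  have e0 : e != 0 by rewrite gt_eqF.
  have : p * n%:Z + j%:Z = q * n%:Z + k%:Z.
    by apply: (mulIf e0); rewrite !mulrDl -!mulrA -xE -yE.
  move=> /(congr1 (fun z => (z %% n%:Z)%Z)).
  by rewrite !modzMDl !modz_small ?ltz_nat // => -[].
Qed.

End ExtensionDegree.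
End Centralizer.

(** * The centralizers of all noncentral elements *)

Lemma aut_exp_free (L : fieldType) (s : field_aut L) :
    (forall l, ~ fixed_set s l -> forall i, (1 <= i)%N -> iter i s l <> l) ->
  forall l j, j != 0 -> aut_exp s j l = l -> s l = l.
Proof.
move=> free l j j0 jl; apply: contrapT => sl.
have iter_fix i : (0 < i)%N -> iter i s l <> l by apply: free.
case: j j0 jl => [[//|i] _|i _] jl; first exact: iter_fix jl.
apply: (iter_fix i.+1) => //; rewrite -{1}jl -[Negz i]/(- i.+1%:Z).
by rewrite -[LHS]/(aut_exp s i.+1%:Z _) -aut_expD subrr.
Qed.

Lemma skew_noncommutative (L : fieldType) (s : field_aut L) :
  ~ (s =1 id) -> exists a b : skew_laurent s, a * b <> b * a.
Proof.
move=> s1; have [l sl] : exists l, s l <> l by apply/existsNP => sl; apply: s1.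
exists (X s), (const s l) => /(congr1 (fun a => coef a 1)).
by rewrite X_const !coef_constM coef_monomial eqxx !mulr1.
Qed.

Section Centralizers.
Variables (L : fieldType) (s : field_aut L).
Hypothesis s_free : forall (l : L) k, k != 0 -> aut_exp s k l = l -> s l = l.
Implicit Types u v : skew_laurent s.

Lemma deg_neq0P u : ~ range (const s) u -> deg u <> 0%E ->
  exists2 d, is_deg u d & d != 0.
Proof.
move=> uL u0; have [d ud] : exists d, is_deg u d.
  by apply: is_deg_ex; apply: contra_not_neq uL => ->; exists 0; rewrite ?rmorph0.
by exists d => //; apply: contra_not_neq u0 => d0; rewrite (degE ud) d0.
Qed.

(** If [deg u = q e] with [q < 0], the extension degree is computed with [u^-1] in place of
    [u], which has the same centralizer and generates the same field of series. *)
Lemma centralizer_deg_neq0 u v (d : int) : is_deg u d -> d != 0 ->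
    least_pos_deg (centralizer u) v ->
  [/\ centralizer u = series_in v,
      laurent_series_field_in v (centralizer u)
    & exists n : nat,
        n%:R = `|(fine (deg u))%:~R / (fine (deg v))%:~R| :> rat /\
        has_ext_degree (series_in u) (centralizer u) `I_n].
Proof.
move=> ud d0 /least_pos_degP[e [vC ve e0 Cdeg]].
have [CE Claurent] := centralizer_laurent s_free ud d0 vC ve e0 Cdeg.
split=> //; have [q dE] := Cdeg u d (erefl : centralizer u u) ud.
have q0 : q != 0 by apply: contraNneq d0 => q0; rewrite dE q0 mul0r.
exists (absz q); split.
  rewrite (degE ud) (degE ve) /= dE intrM mulfK ?intr_eq0 ?gt_eqF //.
  by rewrite natr_absz intr_norm.
have n0 : (0 < absz q)%N by rewrite absz_gt0.
case: (ltgtP q 0) q0 => // qs _.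
  have ud' : is_deg u^-1 ((absz q)%:Z * e).
    by rewrite (_ : _ * e = - d); [exact: is_degV | rewrite dE; lia].
  have CV := centralizer_inv (is_deg_unit ud).
  rewrite -(series_in_inv ud) -CV.
  by apply: (centralizer_ext_degree s_free e0 n0 ud' _ ve); rewrite CV.
apply: (centralizer_ext_degree s_free e0 n0 _ vC ve Cdeg).
by rewrite (_ : _ * e = d) // dE; lia.
Qed.

Lemma centralizer_deg_neq0_commutative u (d : int) : is_deg u d -> d != 0 ->
  {in centralizer u &, commutative *%R}.
Proof.
move=> ud d0; have [v /least_pos_degP[e [vC ve e0 Cdeg]]] := least_pos_deg_exists ud d0.
exact: (centralizer_commutative s_free ud d0 vC ve e0 Cdeg).
Qed.

(** Constants fixed by [s] are central, so when the leading coefficient of a series of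
    degree [0] is fixed, it can be subtracted without changing the centralizer. This
    leaves a series of negative degree. *)
Lemma noncentral_centralizer_commutative u :
  (exists a, ~ GRing.comm a u) -> {in centralizer u &, commutative *%R}.
Proof.
move=> [a au].
have [[l _ lu]|uL] := pselect (range (const s) u).
  rewrite -lu in au *; have sl : s l <> l by move=> sl; apply/au/const_fixed_comm.
  rewrite (centralizer_const s_free sl) => _ _ /set_mem[x _ <-] /set_mem[y _ <-].
  by rewrite -!rmorphM mulrC.
have [u0|/(deg_neq0P uL)[d ud d0]] := pselect (deg u = 0%E); last first.
  exact: (centralizer_deg_neq0_commutative ud d0).
have ule : deg_le u 0 by apply/deg_leP; rewrite u0.
have [sl|sl] := eqVneq (s (coef u 0)) (coef u 0); last first.
  by have [] := centralizer_deg0_iso s_free ule; first exact/eqP.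
pose u' := u - const s (coef u 0).
have CE : centralizer u = centralizer u'.
  by apply/seteqP; split=> c /(comm_subr_const c u sl).
have u'0 : u' != 0.
  by apply: contra_not_neq uL => /eqP; rewrite subr_eq0 => /eqP ->; exists (coef u 0).
have [d u'd] := is_deg_ex u'0.
rewrite CE; apply: centralizer_deg_neq0_commutative (u'd) _.
apply: contraTneq isT => d0; case: u'd; rewrite d0 coefB coef_monomial eqxx.
by rewrite subrr eqxx.
Qed.

End Centralizers.

Theorem theorem5p1 (L : fieldType) (s : field_aut L)
    (s_neq_id : ~ (s =1 id))
    (s_free : forall l : L, ~ fixed_set s l ->
      forall i : nat, (1 <= i)%N -> iter i s l <> l) :
  [/\ commutative_centralizer_condition (skew_laurent s),
      (forall l : L, ~ fixed_set s l ->
        centralizer (const s l) = range (const s)),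
      (forall u : skew_laurent s,
        ~ range (const s) u -> deg u = 0%E -> ~ fixed_set s (leading_coef u) ->
        [/\ centralizer u `<=` nonpos_deg s,
            fixed_algebra_iso (centralizer u) residue
          & exists D : set L,
              has_ext_degree (adjoin (fixed_consts s) u) (centralizer u) D /\
              has_ext_degree (adjoin (fixed_set s) (leading_coef u)) [set: L] D])
    & (forall u : skew_laurent s,
        ~ range (const s) u -> deg u <> 0%E ->
        (exists v, least_pos_deg (centralizer u) v) /\
        forall v, least_pos_deg (centralizer u) v ->
          [/\ centralizer u = series_in v,
              laurent_series_field_in v (centralizer u)
            & exists n : nat,
                n%:R = `|(fine (deg u))%:~R / (fine (deg v))%:~R| :> rat /\
                has_ext_degree (series_in u) (centralizer u) `I_n])].
Proof.
have free := aut_exp_free s_free; split.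
- split; first exact: skew_noncommutative.
  by move=> u; apply: noncentral_centralizer_commutative.
- by move=> l; apply: centralizer_const.
- move=> u _ u0; rewrite /leading_coef u0 => sl.
  have ule : deg_le u 0 by apply/deg_leP; rewrite u0.
  by have [] := centralizer_deg0_iso free ule sl.
- move=> u uL u0; have [d ud d0] := deg_neq0P uL u0; split.
    exact: least_pos_deg_exists ud d0.
  by move=> v; apply: centralizer_deg_neq0 ud d0.
Qed.
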